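(* Let $\nu_t$ be the distribution at time $t$ of the single-site dynamics started from the minimal configuration ($\eta(i)=0$ for all $i\in[1,n]$). Then for some time $t_n=\tilde O(n^3)$ we have $\|\nu_{t_n}-\mu\|=o(1)$.
   Context: Fix $\beta>0$, integer $n\ge2$. $\Omega_n=\{0,\dots,n\}^n$ with boundary values $\eta(0)=\eta(n+1)=0$; $\mu(\eta)\propto\exp\{-\beta\sum_{i=1}^{n+1}|\eta(i-1)-\eta(i)|\}$. Single-site dynamics: pick $i\in\{1,\dots,n\}$ uniformly, let $a=\min\{\eta(i\pm1)\}$, $b=\max\{\eta(i\pm1)\}$; replace $\eta(i)$ by $\max\{\eta(i)-1,0\}$ with probability $p^-$ and by $\min\{\eta(i)+1,n\}$ with probability $p^+$, else do nothing, with $p^-=\frac14e^{-2\beta}$ if $\eta(i)\le a$, else $\frac14$; $p^+=\frac14e^{-2\beta}$ if $\eta(i)\ge b$, else $\frac14$. $\|\cdot\|$ is total variation distance; $\tilde O$ hides polylogarithmic factors in $n$; asymptotics as $n\to\infty$. *)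

(* Defs.v *)
From HB Require Import structures.
From mathcomp Require Import all_boot all_order all_algebra.
From mathcomp Require Import all_classical all_reals all_analysis.
Set Implicit Arguments. Unset Strict Implicit. Unset Printing Implicit Defensive.
Import Order.TTheory GRing.Theory Num.Theory.
Local Open Scope ring_scope.

(* Configurations: eta : 'I_n -> {0..n}; site i : 'I_n stands for position i+1. *)
Definition config (n : nat) := {ffun 'I_n -> 'I_n.+1}.

(* height at position j in {0,...,n+1}, with boundary values 0 at 0 and n+1 *)
Definition hgt (n : nat) (eta : config n) (j : nat) : nat :=
  if (0 < j)%N then oapp (fun i : 'I_n => val (eta i)) 0%N (insub j.-1) else 0%N.

Definition absdiff (a b : nat) : nat := ((a - b) + (b - a))%N.

Definition energy (n : nat) (eta : config n) : nat :=
  (\sum_(j < n.+1) absdiff (hgt eta j) (hgt eta j.+1))%N.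

Section Model.
Variables (R : realType) (beta : R) (n : nat).

Definition weight (eta : config n) : R := expR (- (beta * (energy eta)%:R)).
Definition partZ : R := \sum_(eta : config n) weight eta.
Definition mu (eta : config n) : R := weight eta / partZ.

Definition setsite (eta : config n) (i : 'I_n) (v : 'I_n.+1) : config n :=
  [ffun k => if k == i then v else eta k].

Definition down (eta : config n) (i : 'I_n) : config n :=
  setsite eta i (inord (val (eta i)).-1).
Definition up (eta : config n) (i : 'I_n) : config n :=
  setsite eta i (inord (minn (val (eta i)).+1 n)).

Definition nbmin (eta : config n) (i : 'I_n) : nat :=
  minn (hgt eta i) (hgt eta i.+2).
Definition nbmax (eta : config n) (i : 'I_n) : nat :=
  maxn (hgt eta i) (hgt eta i.+2).

Definition pminus (eta : config n) (i : 'I_n) : R :=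
  if (val (eta i) <= nbmin eta i)%N then expR (- (2 * beta)) / 4 else 1 / 4.
Definition pplus (eta : config n) (i : 'I_n) : R :=
  if (nbmax eta i <= val (eta i))%N then expR (- (2 * beta)) / 4 else 1 / 4.

Definition trans (eta eta' : config n) : R :=
  \sum_(i < n) n%:R^-1 *
     (pminus eta i * (eta' == down eta i)%:R
      + pplus eta i * (eta' == up eta i)%:R
      + (1 - pminus eta i - pplus eta i) * (eta' == eta)%:R).

Definition minconf : config n := [ffun => ord0].

Fixpoint nu (t : nat) : config n -> R :=
  match t with
  | 0%N => fun eta => (eta == minconf)%:R
  | t'.+1 => fun eta' => \sum_(eta : config n) nu t' eta * trans eta eta'
  end.

Definition tv_to_mu (t : nat) : R :=
  2^-1 * \sum_(eta : config n) `|nu t eta - mu eta|.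
End Model.

(* Main.v *)
Require Import Defs.
From HB Require Import structures.
From mathcomp Require Import all_boot all_order all_algebra.
From mathcomp Require Import all_classical all_reals all_analysis.
From mathcomp Require Import zify ring lra.
Set Implicit Arguments. Unset Strict Implicit. Unset Printing Implicit Defensive.
Import Order.TTheory GRing.Theory Num.Theory numFieldNormedType.Exports.
Local Open Scope ring_scope.

(* By Peres-Winkler censoring, the law at time [t] of the dynamics started from the
   minimum stays above that of a dynamics with fewer updates: here blocks of
   [T = n polylog(n)] steps restricted alternately to the odd and to the even sites,
   during which each updated column relaxes between frozen neighbours. Since the
   law has a decreasing density, its total variation distance to [mu] is at most
   [sum_i h_i], where [h_i] is the deficit of the mean height at [i]. The
   equilibrium mean of a column with neighbours [l], [r] is [(l + r) / 2 + c(l, r)]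
   with [c] decreasing, so that, up to a relaxation error, a block replaces [h_i] by at
   most the average of [h_(i-1)] and [h_(i+1)]: [n ^ 2 log n] rounds of this discrete
   heat equation make [h] negligible. The relaxation error is small because
   gradients above [C log n] are unlikely under any decreasing density. *)

(** The length of a block is dictated by the relaxation bound of a column, which grows like the
    square of the distance between its neighbours: without control of gradients a block could cost
    [n ^ 3] steps. That control is not immediate, since the path has to return to [0] while staying
    between two walls, and this conditioning tilts the law of a jump. The tilt from height [v] to
    height [z] is a ratio of values of [hitw]. It is polynomial in [n]: total positivity compares it
    with a ratio of masses of the walk killed at the walls, and a concave parabola, almost an
    eigenfunction, pins these masses down. A polynomial price is harmless against geometric decay
    over a distance [C log n]. All estimates are one-sided: only upper bounds on the deficits are
    propagated, so a column that starts far above its neighbours causes no loss, and the walls enter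
    the recursion only through the monotonicity of [c]. The deficits are dominated by a multiple of
    [j (n + 1 - j)], which averaging over the two neighbours lowers by a constant, so that no
    spectral analysis of the heat equation is needed. *)

(** * Monotone likelihood ratios and total positivity of the edge kernel *)

(** Chebyshev's association inequality: after symmetrisation in [(i, j)], twice the difference is a
    sum of products of [phi i - phi j] and [b i * a j - a i * b j], two factors of the same sign. *)
Lemma mlr_sum (R : realFieldType) m (a b phi : 'I_m -> R) :
  (forall i j : 'I_m, (i <= j)%N -> a j * b i <= a i * b j) ->
  (forall i j : 'I_m, (i <= j)%N -> phi i <= phi j) ->
  (\sum_i a i * phi i) * (\sum_i b i) <= (\sum_i b i * phi i) * (\sum_i a i).
Proof.
move=> hab hphi; rewrite -subr_ge0.
set X := (X in 0 <= X).
have X1 : X = \sum_i \sum_j phi i * (b i * a j - a i * b j).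
  rewrite /X !big_distrlr -sumrB; apply: eq_bigr => i _.
  by rewrite -sumrB; apply: eq_bigr => j _ /=; ring.
have X2 : X = \sum_i \sum_j - (phi j * (b i * a j - a i * b j)).
  rewrite X1 exchange_big; apply: eq_bigr => i _; apply: eq_bigr => j _; ring.
suff : 0 <= X + X by move=> h; lra.
rewrite {1}X1 X2 -big_split; apply: sumr_ge0 => i _.
rewrite -big_split; apply: sumr_ge0 => j _ /=.
rewrite -mulrBl; case: (leqP i j) => [ij|/ltnW ji].
  by rewrite mulr_le0 // subr_le0 ?hphi // [leLHS]mulrC hab.
by rewrite mulr_ge0 // subr_ge0 ?hphi // [leRHS]mulrC hab.
Qed.

Section Kernel.
Variables (R : realFieldType) (q : R) (n : nat).
Hypotheses (q0 : 0 < q) (q1 : q < 1).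

Definition kq (x y : nat) : R := q ^+ absdiff x y.

(** Transfer operator of the path measure; the sum stops at [0] and [n], which amounts to killing
    the walk at the walls. *)
Definition kop (phi : nat -> R) (x : nat) : R := \sum_(y < n.+1) kq x y * phi y.

Lemma kq_gt0 x y : 0 < kq x y.
Proof. exact: exprn_gt0. Qed.

Lemma kq_tp2 x x' y y' : (x <= x')%N -> (y <= y')%N ->
  kq x y' * kq x' y <= kq x y * kq x' y'.
Proof.
move=> hx hy; rewrite -!exprD; apply: ler_wiXn2l; [exact: ltW|exact: ltW|].
by rewrite /absdiff; lia.
Qed.

Lemma kop_gt0 phi x : (forall y, 0 < phi y) -> 0 < kop phi x.
Proof.
move=> h; rewrite /kop big_ord_recl ltr_pwDl ?mulr_gt0 ?kq_gt0 //.
by apply: sumr_ge0 => i _; rewrite mulr_ge0 ?ltW ?kq_gt0.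
Qed.

Lemma kop_le phi psi x : (forall y, (y <= n)%N -> phi y <= psi y) ->
  kop phi x <= kop psi x.
Proof.
move=> h; apply: ler_sum => y _; apply: ler_wpM2l; first exact/ltW/kq_gt0.
by apply: h; rewrite -ltnS.
Qed.

Lemma kopZ c phi x : kop (fun y => c * phi y) x = c * kop phi x.
Proof. by rewrite /kop mulr_sumr; apply: eq_bigr => y _; ring. Qed.

(** [kop psi x / kop phi x] is the average of [psi / phi] under the weights [kq x * phi], and these
    move upwards with [x] because the kernel is totally positive. *)
Lemma kop_mlr (phi psi : nat -> R) :
  (forall y, 0 < phi y) ->
  (forall v z, (v <= z)%N -> phi z * psi v <= phi v * psi z) ->
  forall v z, (v <= z)%N -> kop phi z * kop psi v <= kop phi v * kop psi z.
Proof.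
move=> phi0 h v z vz.
have := @mlr_sum R n.+1 (fun i => kq v i * phi i) (fun i => kq z i * phi i)
  (fun i => psi i / phi i).
have E x : \sum_(i < n.+1) kq x i * phi i * (psi i / phi i) = kop psi x.
  apply: eq_bigr => i _; rewrite -mulrA; congr (_ * _).
  by rewrite mulrCA divff ?mulr1 // gt_eqF.
rewrite !E -!/(kop phi _) => H; rewrite [leLHS]mulrC [leRHS]mulrC; apply: H => i j ij.
  rewrite mulrACA [leRHS]mulrACA [phi i * _]mulrC.
  by apply: ler_wpM2r; [rewrite mulr_ge0 ?ltW|exact: kq_tp2].
by rewrite ler_pdivrMr // mulrAC ler_pdivlMr // mulrC [leRHS]mulrC h.
Qed.

End Kernel.

(** * Growth of the iterated transfer operator *)

Section KernelGrowth.
Variables (R : realFieldType) (q : R) (n : nat).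
Hypotheses (q0 : 0 < q) (q1 : q < 1).
Let q'0 : 0 < 1 - q. Proof. by rewrite subr_gt0. Qed.

Lemma kop_split (phi : nat -> R) x : (x <= n)%N ->
  kop q n phi x = \sum_(j < x.+1) q ^+ j * phi (x - j)%N
    + \sum_(j < (n - x).+1) q ^+ j * phi (x + j)%N - phi x.
Proof.
move=> xn; rewrite /kop -(big_mkord xpredT (fun y => kq q x y * phi y)).
rewrite (@big_cat_nat _ _ _ x) //=; last exact: leqW.
rewrite [X in _ = X + _ - _]big_ord_recl expr0 mul1r subn0 addrAC (addrC (phi x)) addrK.
congr (_ + _).
  rewrite big_nat_rev /= add0n big_mkord; apply: eq_bigr => j _.
  by congr (q ^+ _ * phi _); have := ltn_ord j; rewrite /absdiff /bump /=; lia.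
rewrite -{1}[x]add0n big_addn big_mkord -subSn //; apply: eq_bigr => j _.
by congr (q ^+ _ * phi _); rewrite /absdiff; lia.
Qed.

Lemma geom_le m : \sum_(j < m) q ^+ j <= (1 - q)^-1.
Proof.
rewrite -[leRHS]mul1r ler_pdivlMr // mulrC -opprB mulNr -subrX1 opprB.
by rewrite gerBl exprn_ge0 // ltW.
Qed.

(** Total mass of [q ^ |k|] over all integers [k], the growth rate of the walk without walls. *)
Definition lam : R := (1 + q) / (1 - q).

Lemma lam_gt0 : 0 < lam.
Proof. by rewrite divr_gt0 // addr_gt0. Qed.

Lemma kop1_le x : (x <= n)%N -> kop q n (fun=> 1) x <= lam.
Proof.
move=> xn; rewrite kop_split // -!mulr_suml !mulr1.
have h := geom_le; have -> : lam = (1 - q)^-1 + (1 - q)^-1 - 1.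
  by rewrite /lam; field; rewrite gt_eqF.
by rewrite lerD2r lerD.
Qed.

(** Concave parabola vanishing at [-1] and [n + 1], the first heights beyond the walls; an
    approximate eigenfunction of [kop] for [lam]. *)
Definition psi (y : nat) : R := (y%:R + 1) * (n%:R + 1 - y%:R).

Lemma psi_ge y : (y <= n)%N -> n%:R + 1 <= psi y.
Proof.
rewrite /psi -(ler_nat R) => yn; have y0 : 0 <= y%:R :> R by [].
rewrite -subr_ge0; have -> : (y%:R + 1) * (n%:R + 1 - y%:R) - (n%:R + 1) =
  y%:R * (n%:R - y%:R) :> R by ring.
by rewrite mulr_ge0 // subr_ge0.
Qed.

Lemma psi_le y : (y <= n)%N -> psi y <= (n%:R + 1) ^+ 2.
Proof.
rewrite /psi -(ler_nat R) => yn; have y0 : 0 <= y%:R :> R by [].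
by rewrite expr2 ler_pM //; lra.
Qed.

(** The lower bound is the infinite sum over all [j >= 0] of the polynomial extended to negative
    heights. The terms with [j > y] that truncation removes are nonpositive, since the polynomial
    vanishes at [-1] and is negative below. *)
Lemma psi_left y :
  psi y / (1 - q) - (n%:R - 2 * y%:R) * (q / (1 - q) ^+ 2)
    - q * (1 + q) / (1 - q) ^+ 3
  <= \sum_(j < y.+1) q ^+ j * psi (y - j)%N.
Proof.
elim: y => [|y IH].
  rewrite big_ord_recl big_ord0 /psi expr0 mul1r addr0 /= subr0 add0r mul1r.
  rewrite -subr_ge0; set w := (X in 0 <= X).
  have -> : w = n%:R * (q / (1 - q)) ^+ 2 + q ^+ 2 * (3 - q) / (1 - q) ^+ 3.
    by rewrite /w; field; rewrite gt_eqF.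
  rewrite addr_ge0 // mulr_ge0 ?sqr_ge0 ?invr_ge0 ?exprn_ge0 ?(ltW q'0) //.
  by rewrite mulr_ge0 ?sqr_ge0 // subr_ge0 (le_trans (ltW q1)) // ler1n.
rewrite big_ord_recl expr0 mul1r subn0.
have -> : \sum_(i < y.+1) q ^+ bump 0 i * psi (y.+1 - bump 0 i) =
  q * \sum_(j < y.+1) q ^+ j * psi (y - j)%N.
  rewrite mulr_sumr; apply: eq_bigr => i _; rewrite /bump /= add1n subSS exprS.
  by rewrite mulrA.
rewrite -lerBlDl; apply: le_trans (ler_wpM2l (ltW q0) IH).
rewrite le_eqVlt; apply/orP; left; apply/eqP.
by rewrite /psi -natr1; field; rewrite gt_eqF.
Qed.

Lemma psi_sym y : (y <= n)%N -> psi (n - y) = psi y.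
Proof. by move=> yn; rewrite /psi natrB //; ring. Qed.

(** Twice the second moment of [q ^ |k|] over the integers. *)
Definition growth_loss : R := 4 * q * (1 + q) / (1 - q) ^+ 3.

Lemma growth_loss_ge0 : 0 <= growth_loss.
Proof.
rewrite /growth_loss divr_ge0 ?exprn_ge0 ?(ltW q'0) //.
by rewrite !mulr_ge0 ?addr_ge0 ?(ltW q0).
Qed.

Lemma growth_ge0 : 0 <= 1 + growth_loss / (n%:R + 1).
Proof. by rewrite addr_ge0 // divr_ge0 ?growth_loss_ge0 // addr_ge0. Qed.

(** The first-order terms of the two half-sums cancel under [y -> n - y]; only the constant
    second-order term is lost. *)
Lemma kop_psi y : (y <= n)%N ->
  lam * psi y - growth_loss / 2 <= kop q n psi y.
Proof.
move=> yn; rewrite kop_split //.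
have -> : \sum_(j < (n - y).+1) q ^+ j * psi (y + j) =
  \sum_(j < (n - y).+1) q ^+ j * psi (n - y - j).
  apply: eq_bigr => j _; have := ltn_ord j => jn; congr (_ * _).
  rewrite -psi_sym; [congr psi; lia|lia].
have h1 := psi_left y; have h2 := psi_left (n - y).
apply: le_trans (lerB (lerD h1 h2) (lexx _)).
rewrite psi_sym // natrB // /growth_loss /lam.
rewrite le_eqVlt; apply/orP; left; apply/eqP.
by field; rewrite gt_eqF.
Qed.

(** Since [psi >= n + 1], the absolute loss of [kop_psi] is a relative loss of order [1 / n], so
    that [n] applications of the operator cost only a bounded factor. *)
Lemma kop_psi_ge y : (y <= n)%N ->
  lam * psi y <= (1 + growth_loss / (n%:R + 1)) * kop q n psi y.
Proof.
move=> yn; have h := kop_psi yn; have hc := growth_loss_ge0; have hp := psi_ge yn.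
have N0 : 0 < n%:R + 1 :> R by rewrite ltr_wpDl.
have p0 : 0 < psi y by apply: lt_le_trans hp.
have L1 : 1 <= lam by rewrite /lam ler_pdivlMr // mul1r; move: q0 => ?; lra.
have kp : psi y <= kop q n psi y.
  rewrite /kop (bigD1 (Ordinal (yn : (y < n.+1)%N))) //= /kq /absdiff subnn expr0 mul1r.
  rewrite lerDl; apply: sumr_ge0 => i _; apply: mulr_ge0; first exact/ltW/kq_gt0.
  by apply: le_trans (psi_ge _); [exact: ltW|rewrite -ltnS].
set c := growth_loss in h hc *; set k := kop q n psi y in h kp *.
set N := n%:R + 1 in hp N0 *.
have cN0 : 0 <= c / N by rewrite divr_ge0 // ltW.
have [hN|hN] := leP N c.
  have : lam * psi y <= k + c / 2 by lra.
  have : c <= c / N * k.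
    by rewrite mulrAC ler_pdivlMr // ler_wpM2l // (le_trans hp).
  by move=> ? ?; lra.
have t1 : c / N <= 1 by rewrite ler_pdivrMr // mul1r ltW.
have e : c <= c / N * psi y by rewrite mulrAC ler_pdivlMr // ler_wpM2l.
have -> : (1 + c / N) * k = k + c / N * k by ring.
have : c / N * (psi y / 2) <= c / N * k by rewrite ler_wpM2l //; lra.
by move=> ?; lra.
Qed.

(** Weight of the paths that start at a given height, cross [m] further columns and then step to the
    boundary value [0]. *)
Definition hitw (m : nat) : nat -> R := iter m (kop q n) (fun z => q ^+ z).

Lemma iter_kop_gt0 m phi x : (forall y, 0 < phi y) -> 0 < iter m (kop q n) phi x.
Proof.
move=> h; elim: m x => [|m IH] x /=; first exact: h.
exact: kop_gt0.
Qed.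

Lemma hitw_gt0 m x : 0 < hitw m x.
Proof. by apply: iter_kop_gt0 => y; exact: exprn_gt0. Qed.

Lemma iter_kop1_le m x : (x <= n)%N -> iter m (kop q n) (fun=> 1) x <= lam ^+ m.
Proof.
elim: m x => [|m IH] x xn /=; first by rewrite expr0.
rewrite exprSr; apply: (@le_trans _ _ (kop q n (fun=> lam ^+ m * 1) x)).
  by apply: kop_le => // y yn; rewrite mulr1 IH.
rewrite kopZ.
by rewrite ler_wpM2l ?exprn_ge0 ?kop1_le // ltW // lam_gt0.
Qed.

Lemma iter_kop_psi m y : (y <= n)%N ->
  lam ^+ m * psi y
    <= (1 + growth_loss / (n%:R + 1)) ^+ m * iter m (kop q n) psi y.
Proof.
elim: m y => [|m IH] y yn /=; first by rewrite !expr0.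
set E := 1 + _ in IH *.
have E0 : 0 <= E := growth_ge0.
rewrite exprSr -mulrA.
apply: (@le_trans _ _ (lam ^+ m * (E * kop q n psi y))).
  by rewrite ler_wpM2l ?exprn_ge0 ?(ltW lam_gt0) // kop_psi_ge.
rewrite mulrCA exprS -[leRHS]mulrA ler_wpM2l // -!kopZ.
exact: kop_le.
Qed.

(* The ratio of [hitw] to the killed-walk mass is nonincreasing in the starting
   height, by total positivity; the mass itself is known up to a factor. *)
Lemma hitw_le N v z : (v <= z <= n)%N ->
  hitw N z <= (n%:R + 1) * (1 + growth_loss / (n%:R + 1)) ^+ N * hitw N v.
Proof.
move=> /andP[vz zn]; have vn := leq_trans vz zn.
have TP : forall m a b, (a <= b)%N ->
    hitw m b * iter m (kop q n) (fun=> 1) a <= hitw m a * iter m (kop q n) (fun=> 1) b.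
  elim=> [|m IH] a b ab /=.
    by rewrite !mulr1 ler_wiXn2l // ltW.
  by apply: kop_mlr => // y; exact: hitw_gt0.
have {}TP := TP N _ _ vz.
set E := _ ^+ N; set M := n%:R + 1 : R; set I := iter N (kop q n) (fun=> 1) in TP.
have M0 : 0 < M by rewrite /M ltr_wpDl.
have E0 : 0 <= E.
  by rewrite exprn_ge0 // growth_ge0.
have Iz : I z <= lam ^+ N by exact: iter_kop1_le.
(* [psi <= M ^ 2] turns the growth of [psi] into a lower bound on the mass, and [psi v >= M] at the
   start gives one factor [M] back. *)
have Iv : lam ^+ N <= E * (M * I v).
  have h1 := iter_kop_psi N vn; have h2 := psi_ge vn.
  have h3 : iter N (kop q n) psi v <= M ^+ 2 * I v.
    rewrite /I; elim: (N) v vn {h1 h2 vz TP Iz} => [|m IH] v vn /=.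
      by rewrite mulr1 psi_le.
    by rewrite -kopZ; apply: kop_le.
  rewrite -(ler_pM2r M0); apply: (le_trans (ler_wpM2l _ h2)).
    by rewrite exprn_ge0 // ltW // lam_gt0.
  apply: (le_trans h1); rewrite -/E -[leRHS]mulrA ler_wpM2l //.
  by apply: (le_trans h3); rewrite expr2 mulrAC -mulrA mulrA mulrAC.
have L0 : 0 < lam ^+ N by rewrite exprn_gt0 // lam_gt0.
have S0 := hitw_gt0 N v; have S1 := hitw_gt0 N z.
rewrite -(ler_pM2r L0); apply: (@le_trans _ _ (hitw N z * (E * (M * I v)))).
  by rewrite ler_pM2l.
have -> : hitw N z * (E * (M * I v)) = E * M * (hitw N z * I v) by ring.
have -> : M * E * hitw N v * lam ^+ N = E * M * (hitw N v * lam ^+ N) by ring.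
rewrite ler_wpM2l ?mulr_ge0 ?(ltW M0) //; apply: (le_trans TP).
by rewrite ler_pM2l.
Qed.

End KernelGrowth.

(** * Equilibrium mean of one column between fixed neighbours *)

Section ColumnMean.
Variables (R : realFieldType) (q : R) (n : nat).
Hypotheses (q0 : 0 < q) (q1 : q < 1).

Definition wcol (l r z : nat) : R := kq q l z * kq q z r.

Definition wcol_mass l r : R := \sum_(z < n.+1) wcol l r z.

Definition colmean l r : R := (\sum_(z < n.+1) wcol l r z * z%:R) / wcol_mass l r.

Lemma wcol_gt0 l r z : 0 < wcol l r z.
Proof. by rewrite mulr_gt0 // kq_gt0. Qed.

Lemma wcol_mass_gt0 l r : 0 < wcol_mass l r.
Proof.
rewrite /wcol_mass big_ord_recl ltr_pwDl ?wcol_gt0 //.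
by apply: sumr_ge0 => i _; exact/ltW/wcol_gt0.
Qed.

Lemma kqC x y : kq q x y = kq q y x.
Proof. by rewrite /kq /absdiff addnC. Qed.

Lemma wcolC l r z : wcol l r z = wcol r l z.
Proof. by rewrite /wcol mulrC kqC [kq q l z]kqC. Qed.

Lemma colmeanC l r : colmean l r = colmean r l.
Proof.
by rewrite /colmean /wcol_mass; congr (_ / _); apply: eq_bigr => z _; rewrite wcolC.
Qed.

Lemma colmean_rev l r : (l <= n)%N -> (r <= n)%N ->
  colmean (n - l) (n - r) = n%:R - colmean l r.
Proof.
move=> ln rn.
have W z : (z <= n)%N -> wcol (n - l) (n - r) (n - z) = wcol l r z.
  by move=> zn; rewrite /wcol /kq /absdiff; congr (q ^+ _ * q ^+ _); lia.
have M : wcol_mass (n - l) (n - r) = wcol_mass l r.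
  rewrite /wcol_mass (reindex_inj rev_ord_inj); apply: eq_bigr => z _ /=.
  by rewrite subSS W // -ltnS.
rewrite /colmean M -[n%:R](mulfK (lt0r_neq0 (wcol_mass_gt0 l r))) -mulrBl.
congr (_ / _); rewrite (reindex_inj rev_ord_inj) /wcol_mass mulr_sumr -sumrB.
apply: eq_bigr => z _ /=; have zn : (z <= n)%N by rewrite -ltnS.
by rewrite subSS W // natrB //; ring.
Qed.

Lemma colmean_center l r (c : R) :
  colmean l r = c + (\sum_(z < n.+1) wcol l r z * (z%:R - c)) / wcol_mass l r.
Proof.
have W0 := lt0r_neq0 (wcol_mass_gt0 l r).
rewrite -[c in c + _](mulfK W0) -mulrDl; congr (_ / _).
rewrite /wcol_mass mulr_sumr -big_split /=; apply: eq_bigr => z _; ring.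
Qed.

(** The extreme case of the bound on the increment of the mean, with neighbours at distance one:
    [1 - X] and [v] are powers of [e] that measure the distances to the lower and the upper wall.
    When [X > 1 - v] the product may be negative, and the whole is rewritten as a square plus
    nonnegative terms. *)
Lemma corner_ineq (e X v : R) : 0 < e -> e < 1 -> 0 <= X -> X <= 1 ->
  0 <= v -> v <= e -> 0 <= (1 - v - X) * (1 - v - e * X) + 2 * X * v * (1 - e).
Proof.
move=> e0 e1 X0 X1 v0 ve.
have eX : e * X <= X by rewrite ler_piMl // ltW.
have eX' : e * X <= e by rewrite ler_piMr // ltW.
have h : 0 <= X * v * (1 - e) by rewrite !mulr_ge0 // subr_ge0 ltW.
have [c|c] := leP X (1 - v).
  have : 0 <= (1 - v - X) * (1 - v - e * X) by rewrite mulr_ge0 //; lra.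
  by move=> ?; lra.
have -> : (1 - v - X) * (1 - v - e * X) + 2 * X * v * (1 - e) =
  X * v * (1 - e) + (X - (1 - v)) ^+ 2 + (1 - e) * X * (1 - X) by ring.
by rewrite addr_ge0 ?addr_ge0 ?sqr_ge0 // mulr_ge0 ?mulr_ge0 ?subr_ge0 // ltW.
Qed.

Lemma split3 (h : nat -> R) l r : (l < r <= n)%N ->
  \sum_(z < n.+1) h z = \sum_(k < l.+1) h (l - k)%N + \sum_(j < r - l) h (l.+1 + j)%N
     + \sum_(i < n - r) h (r.+1 + i)%N.
Proof.
move=> /andP[lr rn]; rewrite -(big_mkord xpredT h) (@big_cat_nat _ _ _ l.+1) //=; last lia.
rewrite -addrA; congr (_ + _).
  rewrite big_mkord (reindex_inj rev_ord_inj); apply: eq_bigr => i _ /=.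
  by rewrite subSS.
rewrite (@big_cat_nat _ _ _ r.+1) /=; [|lia|lia]; congr (_ + _).
  rewrite -{1}[l.+1]add0n big_addn big_mkord subSS.
  by apply: eq_bigr => i _; rewrite addnC.
rewrite -{1}[r.+1]add0n big_addn big_mkord subSS.
by apply: eq_bigr => i _; rewrite addnC.
Qed.

Let e := q ^+ 2.
Let e0 : 0 < e. Proof. exact: exprn_gt0. Qed.
Let e1 : e < 1. Proof. by rewrite /e expr_lt1 // ltW. Qed.

Lemma geom_sum m : (1 - e) * (\sum_(k < m) e ^+ k) = 1 - e ^+ m.
Proof. by rewrite -opprB mulNr -subrX1 opprB. Qed.

Lemma geom_moment m :
  2 * (1 - e) * (\sum_(k < m) e ^+ k * (k%:R + 2^-1)) =
  (1 + e) * (\sum_(k < m) e ^+ k) - 2 * m%:R * e ^+ m.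
Proof.
elim: m => [|m IH]; first by rewrite !big_ord0; ring.
rewrite !big_ord_recr /= mulrDr IH [(1 + e) * (_ + _)]mulrDr -natr1 exprS.
by field.
Qed.

(* Raising the left neighbour multiplies the weight of [z > l] by [1/q^2] relative
   to [z <= l]; without the walls the mean would move by exactly [1/2]. *)
Lemma colmean_incr_lt l r : (l < r <= n)%N ->
  colmean l.+1 r <= colmean l r + 2^-1.
Proof.
move=> lrn; have /andP[lr rn] := lrn.
set M := (r - l)%N; set N := (n - r)%N.
(* Up to a common factor, [a] and [b] are the masses of [z <= l] and [z > l], and [am], [bm] their
   absolute first moments about [l + 1/2]. Raising [l] multiplies [a] and [am] by [e] relative to
   [b] and [bm]. *)
pose a := \sum_(k < l.+1) e ^+ k.
pose am := \sum_(k < l.+1) e ^+ k * (k%:R + 2^-1).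
pose b := M%:R + \sum_(i < N) e ^+ i.+1.
pose bm := \sum_(j < M) (j%:R + 2^-1) + \sum_(i < N) e ^+ i.+1 * (M%:R + i%:R + 2^-1).
pose c := q ^+ M.-1.
have M0 : (0 < M)%N by rewrite /M; lia.
have wl k : (k < l.+1)%N -> wcol l r (l - k) = c * q * e ^+ k.
  move=> kl; rewrite /c /wcol /kq /e -exprM -exprSr -!exprD /absdiff.
  by congr (q ^+ _); rewrite /M; lia.
have wm j : (j < M)%N -> wcol l r (l.+1 + j) = c * q.
  move=> jM; rewrite /c /wcol /kq -exprSr -!exprD /absdiff.
  by congr (q ^+ _); move: jM; rewrite /M; lia.
have wr i : (i < N)%N -> wcol l r (r.+1 + i) = c * q * e ^+ i.+1.
  move=> iN; rewrite /c /wcol /kq /e -exprM -exprSr -!exprD /absdiff.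
  by congr (q ^+ _); rewrite /M; lia.
have vl k : (k < l.+1)%N -> wcol l.+1 r (l - k) = c * e * e ^+ k.
  move=> kl; rewrite /c /wcol /kq /e -exprM -!exprD /absdiff.
  by congr (q ^+ _); rewrite /M; lia.
have vm j : (j < M)%N -> wcol l.+1 r (l.+1 + j) = c.
  move=> jM; rewrite /c /wcol /kq -!exprD /absdiff.
  by congr (q ^+ _); move: jM; rewrite /M; lia.
have vr i : (i < N)%N -> wcol l.+1 r (r.+1 + i) = c * e ^+ i.+1.
  move=> iN; rewrite /c /wcol /kq /e -exprM -!exprD /absdiff.
  by congr (q ^+ _); rewrite /M; lia.
have EW : wcol_mass l r = c * q * (a + b).
  rewrite /wcol_mass (split3 _ lrn) /a /b -addrA mulrDr mulrDr !mulr_sumr.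
  congr (_ + (_ + _)); first by apply: eq_bigr => k _; rewrite wl.
    rewrite (eq_bigr (fun=> c * q)) => [|j _]; last by rewrite wm.
    by rewrite sumr_const card_ord mulr_natr.
  by apply: eq_bigr => i _; rewrite wr.
have EV : wcol_mass l.+1 r = c * (e * a + b).
  rewrite /wcol_mass (split3 _ lrn) /a /b -addrA mulrDr mulrDr mulrA !mulr_sumr.
  congr (_ + (_ + _)); first by apply: eq_bigr => k _; rewrite vl.
    rewrite (eq_bigr (fun=> c)) => [|j _]; last by rewrite vm.
    by rewrite sumr_const card_ord mulr_natr.
  by apply: eq_bigr => i _; rewrite vr.
have rE : r%:R = l%:R + M%:R :> R by rewrite -natrD /M subnKC // ltnW.
have EZ : \sum_(z < n.+1) wcol l r z * (z%:R - (l%:R + 2^-1)) = c * (q * bm - q * am).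
  rewrite (split3 (fun z => wcol l r z * (z%:R - (l%:R + 2^-1))) lrn).
  have -> : \sum_(k < l.+1) wcol l r (l - k) * ((l - k)%:R - (l%:R + 2^-1)) =
      - (c * q * am).
    rewrite /am mulr_sumr -sumrN; apply: eq_bigr => k _.
    by rewrite wl // natrB ?leq_ord //; ring.
  have -> : \sum_(j < M) wcol l r (l.+1 + j) * ((l.+1 + j)%:R - (l%:R + 2^-1)) =
      c * q * \sum_(j < M) (j%:R + 2^-1).
    by rewrite mulr_sumr; apply: eq_bigr => j _; rewrite wm // natrD -natr1; field.
  have -> : \sum_(i < N) wcol l r (r.+1 + i) * ((r.+1 + i)%:R - (l%:R + 2^-1)) =
      c * q * \sum_(i < N) e ^+ i.+1 * (M%:R + i%:R + 2^-1).
    rewrite mulr_sumr; apply: eq_bigr => i _; rewrite wr // natrD -natr1 rE.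
    by field.
  by rewrite /bm; ring.
have EY : \sum_(z < n.+1) wcol l.+1 r z * (z%:R - (l%:R + 2^-1)) = c * (1 * bm - e * am).
  rewrite (split3 (fun z => wcol l.+1 r z * (z%:R - (l%:R + 2^-1))) lrn).
  have -> : \sum_(k < l.+1) wcol l.+1 r (l - k) * ((l - k)%:R - (l%:R + 2^-1)) =
      - (c * e * am).
    rewrite /am mulr_sumr -sumrN; apply: eq_bigr => k _.
    by rewrite vl // natrB ?leq_ord //; ring.
  have -> : \sum_(j < M) wcol l.+1 r (l.+1 + j) * ((l.+1 + j)%:R - (l%:R + 2^-1)) =
      c * 1 * \sum_(j < M) (j%:R + 2^-1).
    by rewrite mulr_sumr; apply: eq_bigr => j _; rewrite vm // natrD -natr1; field.
  have -> : \sum_(i < N) wcol l.+1 r (r.+1 + i) * ((r.+1 + i)%:R - (l%:R + 2^-1)) =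
      c * 1 * \sum_(i < N) e ^+ i.+1 * (M%:R + i%:R + 2^-1).
    rewrite mulr_sumr; apply: eq_bigr => i _; rewrite vr // natrD -natr1 rE.
    by field.
  by rewrite /bm; ring.
rewrite (colmean_center l r (l%:R + 2^-1)) (colmean_center l.+1 r (l%:R + 2^-1)).
rewrite -[leRHS]addrA lerD2l EW EV EZ EY -mulrBr mul1r mulrA.
have c0 : 0 < c by exact: exprn_gt0.
have a0 : 0 < a.
  rewrite /a big_ord_recl expr0 ltr_pwDl //; apply: sumr_ge0 => i _; exact/exprn_ge0/ltW.
pose S := \sum_(i < N) e ^+ i.+1.
have S0 : 0 <= S by apply: sumr_ge0 => i _; exact/exprn_ge0/ltW.
have bS : 1 + S <= b by rewrite /b lerD2r ler1n.
have b0 : 0 < b by apply: lt_le_trans bS; rewrite ltr_pwDl.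
have ab0 : 0 < a + b by exact: addr_gt0.
have eab0 : 0 < e * a + b by rewrite addr_gt0 // mulr_gt0.
rewrite -!mulf_div divff ?gt_eqF // divff ?gt_eqF ?mulr_gt0 // !mul1r.
(* The means differ by [(1 - e) (bm a + am b) / ((a + b) (e a + b))]. The denominator is
   [(1 + e) a b + (e a^2 + b^2)]; the first part will pay for [am b], the second for [bm a]. *)
rewrite -subr_ge0; set w := (X in 0 <= X).
have -> : w = ((a + b) * (e * a + b) - 2 * (1 - e) * (bm * a + am * b))
   / (2 * (a + b) * (e * a + b)).
  by rewrite /w; field; rewrite (gt_eqF ab0) (gt_eqF eab0).
apply: divr_ge0; last by rewrite !mulr_ge0 // ltW.
have ha : 2 * (1 - e) * am <= (1 + e) * a.
  by rewrite /am geom_moment gerBl !mulr_ge0 // exprn_ge0 // ltW.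
set X := (1 - e) * a.
have X1 : X = 1 - e ^+ l.+1 by exact: geom_sum.
have X0 : 0 <= X by rewrite mulr_ge0 ?subr_ge0 ?ltW.
have Xle : X <= 1 by rewrite X1 gerBl exprn_ge0 // ltW.
set v := e ^+ N.+1.
have v0 : 0 <= v by rewrite exprn_ge0 // ltW.
have ve : v <= e by rewrite /v exprS ler_piMr ?(ltW e0) // exprn_ile1 // ltW.
have SE : S = e * \sum_(i < N) e ^+ i.
  by rewrite /S mulr_sumr; apply: eq_bigr => i _; rewrite exprS.
have HS : (1 - e) * S = e - v by rewrite SE mulrCA geom_sum mulrBr mulr1 -exprS.
have hsum m : 2 * (\sum_(j < m) (j%:R + 2^-1)) = m%:R ^+ 2 :> R.
  elim: m => [|m IH]; first by rewrite big_ord0; ring.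
  by rewrite big_ord_recr /= mulrDr IH -natr1; field.
pose tau := \sum_(i < N) e ^+ i.+1 * (i%:R + 2^-1).
have htau : 2 * (1 - e) * tau <= (1 + e) * S.
  have -> : tau = e * \sum_(i < N) e ^+ i * (i%:R + 2^-1).
    by rewrite /tau mulr_sumr; apply: eq_bigr => i _; rewrite exprS mulrA.
  rewrite mulrCA geom_moment SE mulrCA ler_wpM2l ?(ltW e0) //.
  by rewrite gerBl !mulr_ge0 // exprn_ge0 // ltW.
have hb : 2 * bm = M%:R ^+ 2 + 2 * M%:R * S + 2 * tau.
  rewrite /bm mulrDr hsum -addrA; congr (_ + _).
  rewrite /tau /S !mulr_sumr -big_split; apply: eq_bigr => i _ /=; ring.
(* After multiplication by [(1 - e) ^ 2] and the bound [b >= 1 + S], this becomes [corner_ineq]. *)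
have key : 2 * (1 - e) * bm * a <= e * a ^+ 2 + b ^+ 2.
  have E0 : 0 < 1 - e by rewrite subr_gt0.
  have hb2 : (1 - e) * (2 * bm) <= (1 - e) * (b ^+ 2 - S ^+ 2) + (1 + e) * S.
    rewrite hb (_ : b = M%:R + S) //; move: htau => {hb}; lra.
  have -> : 2 * (1 - e) * bm * a = ((1 - e) * (2 * bm)) * a by ring.
  apply: (le_trans (ler_wpM2r (ltW a0) hb2)).
  rewrite -subr_ge0 -(pmulr_rge0 _ E0) -(pmulr_rge0 _ E0).
  have -> : (1 - e) * ((1 - e) * (e * a ^+ 2 + b ^+ 2 -
      ((1 - e) * (b ^+ 2 - S ^+ 2) + (1 + e) * S) * a)) =
    e * X ^+ 2 + ((1 - e) * b) ^+ 2 * (1 - X) + ((1 - e) * S) ^+ 2 * X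
      - (1 + e) * ((1 - e) * S) * X by rewrite /X; ring.
  have hB : 1 - v <= (1 - e) * b.
    apply: (@le_trans _ _ ((1 - e) * (1 + S))); last by rewrite ler_pM2l.
    by rewrite mulrDr HS; lra.
  have hB2 : (1 - v) ^+ 2 * (1 - X) <= ((1 - e) * b) ^+ 2 * (1 - X).
    have v1 : 0 <= 1 - v by rewrite subr_ge0 (le_trans ve) // ltW.
    by rewrite ler_wpM2r ?subr_ge0 // lerXn2r ?nnegrE // (le_trans v1 hB).
  rewrite HS.
  have := corner_ineq e0 e1 X0 Xle v0 ve; move: hB2; set t := (_ * b) ^+ 2 * _.
  by move=> ? ?; lra.
have : 2 * (1 - e) * am * b <= (1 + e) * a * b by rewrite ler_wpM2r // ltW.
by move=> ?; lra.
Qed.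

(** For [r <= l], the reflection [z -> n - z] leads back to a left neighbour below the right one. *)
Lemma colmean_incr l r : (l < n)%N -> (r <= n)%N ->
  colmean l.+1 r <= colmean l r + 2^-1.
Proof.
move=> ln rn; have [lr|rl] := ltnP l r; first by rewrite colmean_incr_lt // lr.
have := @colmean_incr_lt (n - l.+1) (n - r).
rewrite -subSn // subSS !colmean_rev // ?(ltnW ln) // => H.
by have := H ltac:(lia); lra.
Qed.

Lemma colmean_corr_le l r l' r' : (l <= l' <= n)%N -> (r <= r' <= n)%N ->
  colmean l' r' - (l'%:R + r'%:R) / 2 <= colmean l r - (l%:R + r%:R) / 2.
Proof.
have step x y s : (x <= y <= n)%N -> (s <= n)%N ->
    colmean y s - y%:R / 2 <= colmean x s - x%:R / 2.
  move=> /andP[xy yn] sn; elim: y xy yn => [|y IH] xy yn.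
    by move: xy; rewrite leqn0 => /eqP ->.
  move: xy; rewrite leq_eqVlt => /predU1P[->//|xy].
  have := IH xy (ltnW yn); have := colmean_incr yn sn; rewrite -natr1; lra.
move=> hl hr; have /andP[rr rn] := hr; have /andP[ll ln] := hl.
have := step _ _ r' hl rn.
have := step _ _ l hr (leq_trans ll ln).
rewrite (colmeanC r' l) (colmeanC r l); lra.
Qed.

End ColumnMean.

(** * The birth-and-death chain of one column between frozen neighbours *)

Section ColumnChain.
Variables (R : realFieldType) (q : R) (n : nat).
Hypotheses (q0 : 0 < q) (q1 : q < 1).

Definition cpm (l r y : nat) : R := if (y <= minn l r)%N then q ^+ 2 / 4 else 1 / 4.
Definition cpp (l r y : nat) : R := if (maxn l r <= y)%N then q ^+ 2 / 4 else 1 / 4.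

Definition kcol (l r : nat) (u : nat -> R) (y : nat) : R :=
  cpm l r y * u y.-1 + cpp l r y * u (minn y.+1 n)
  + (1 - cpm l r y - cpp l r y) * u y.

Definition nondec (u : nat -> R) := forall y, (y < n)%N -> u y <= u y.+1.

Lemma nondec_le u y z : nondec u -> (y <= z <= n)%N -> u y <= u z.
Proof.
move=> hu /andP[]; elim: z => [|z IH]; first by rewrite leqn0 => /eqP->.
rewrite leq_eqVlt => /predU1P[->//|yz zn].
by apply: le_trans (hu z zn); apply: IH => //; exact: ltnW.
Qed.

Let qq0 : 0 <= q ^+ 2. Proof. by rewrite exprn_ge0 // ltW. Qed.
Let qq1 : q ^+ 2 <= 1. Proof. by rewrite exprn_ile1 // ltW. Qed.

Lemma cpm_bound l r y : 0 <= cpm l r y <= 1 / 4.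
Proof. by rewrite /cpm; case: ifP => _; apply/andP; split; move: qq0 qq1; lra. Qed.

Lemma cpp_bound l r y : 0 <= cpp l r y <= 1 / 4.
Proof. by rewrite /cpp; case: ifP => _; apply/andP; split; move: qq0 qq1; lra. Qed.

Lemma kcol_le l r u v y : (y <= n)%N -> (forall z, (z <= n)%N -> u z <= v z) ->
  kcol l r u y <= kcol l r v y.
Proof.
move=> yn h; have /andP[m0 m1] := cpm_bound l r y.
have /andP[p0 p1] := cpp_bound l r y; rewrite /kcol !lerD // ler_wpM2l //.
- by apply: h; lia.
- by apply: h; lia.
- by lra.
- exact: h.
Qed.

Lemma kcolE l r u y : kcol l r u y =
  u y + cpp l r y * (u (minn y.+1 n) - u y) - cpm l r y * (u y - u y.-1).
Proof. by rewrite /kcol; ring. Qed.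

Lemma kcol_env l r l' r' u y : (y <= n)%N -> nondec u ->
  (l <= l')%N -> (r <= r')%N -> kcol l r u y <= kcol l' r' u y.
Proof.
move=> yn hu ll rr; rewrite !kcolE.
have hp : 0 <= u (minn y.+1 n) - u y by rewrite subr_ge0 nondec_le //; lia.
have hm : 0 <= u y - u y.-1 by rewrite subr_ge0 nondec_le //; lia.
have h1 : cpp l r y <= cpp l' r' y.
  rewrite /cpp; case: ifP => c; case: ifP => d //; first by move: qq1; lra.
  by exfalso; move: c d; lia.
have h2 : cpm l' r' y <= cpm l r y.
  rewrite /cpm; case: ifP => c; case: ifP => d //; first by move: qq1; lra.
  by exfalso; move: c d; lia.
apply: lerB; first by rewrite lerD2l ler_wpM2r.
by rewrite ler_wpM2r.
Qed.

(** The discrete gradient obeys a recursion of its own, with nonnegative coefficients because both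
    rates are at most [1/4]. Preservation of monotonicity and the comparison with an envelope both
    rest on this. *)
Lemma kcol_diff l r u y : (y < n)%N ->
  kcol l r u y.+1 - kcol l r u y =
    (1 - cpm l r y.+1 - cpp l r y) * (u y.+1 - u y)
    + cpp l r y.+1 * (u (minn y.+2 n) - u y.+1) + cpm l r y * (u y - u y.-1).
Proof. by move=> yn; rewrite !kcolE /= (minn_idPl yn); ring. Qed.

Lemma kcol_nondec l r u : nondec u -> nondec (kcol l r u).
Proof.
move=> hu y yn; rewrite -subr_ge0 kcol_diff //.
have /andP[_ m1] := cpm_bound l r y.+1; have /andP[_ p1] := cpp_bound l r y.
have /andP[m0 _] := cpm_bound l r y; have /andP[p0 _] := cpp_bound l r y.+1.
rewrite addr_ge0 ?addr_ge0 ?mulr_ge0 ?subr_ge0 //; try lra.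
- exact: hu.
- by apply: nondec_le => //; lia.
- by apply: nondec_le => //; lia.
Qed.

(** Detailed balance across the edge from [z] to [z + 1]: the weight changes by [q ^ 2] exactly when
    one of the two rates carries that factor and the other does not. *)
Lemma wcol_balance l r z :
  wcol q l r z * cpp l r z = wcol q l r z.+1 * cpm l r z.+1.
Proof.
rewrite /wcol /cpp /cpm /kq -!exprD.
case: ifP => hM; case: ifP => hm.
- by exfalso; move: hM hm; lia.
- have -> : (absdiff l z.+1 + absdiff z.+1 r)%N = (absdiff l z + absdiff z r).+2.
    by move: hM; rewrite /absdiff; lia.
  by rewrite !exprS expr0; field.
- have -> : (absdiff l z + absdiff z r)%N = (absdiff l z.+1 + absdiff z.+1 r).+2.
    by move: hm; rewrite /absdiff; lia.
  by rewrite !exprS expr0; field.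
- congr (q ^+ _ * _); move: hM hm; rewrite /absdiff; lia.
Qed.

(** Summation by parts; moves blocked at [0] and at [n] leave the height unchanged, so there is no
    boundary term. *)
Lemma wcol_dirichlet l r (f g : nat -> R) :
  \sum_(z < n.+1) wcol q l r z * f z * (kcol l r g z - g z) =
  - \sum_(z < n) wcol q l r z * cpp l r z * ((f z.+1 - f z) * (g z.+1 - g z)).
Proof.
have -> : \sum_(z < n.+1) wcol q l r z * f z * (kcol l r g z - g z) =
  \sum_(z < n.+1) wcol q l r z * cpp l r z * f z * (g (minn z.+1 n) - g z)
  - \sum_(z < n.+1) wcol q l r z * cpm l r z * f z * (g z - g z.-1).
  by rewrite -sumrB; apply: eq_bigr => z _; rewrite kcolE; ring.
rewrite big_ord_recr [X in _ - X]big_ord_recl /= (minn_idPr (leqnSn n)) !subrr !mulr0.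
rewrite addr0 add0r -sumrB -sumrN; apply: eq_bigr => z _.
by rewrite /bump /= add1n -wcol_balance (minn_idPl (ltn_ord z)); ring.
Qed.

Lemma wcol_reversible l r (f g : nat -> R) :
  \sum_(z < n.+1) wcol q l r z * f z * kcol l r g z =
  \sum_(z < n.+1) wcol q l r z * kcol l r f z * g z.
Proof.
apply/eqP; rewrite -subr_eq0; apply/eqP.
have := wcol_dirichlet l r f g; have := wcol_dirichlet l r g f.
have -> : \sum_(z < n) wcol q l r z * cpp l r z * ((f z.+1 - f z) * (g z.+1 - g z)) =
  \sum_(z < n) wcol q l r z * cpp l r z * ((g z.+1 - g z) * (f z.+1 - f z)).
  by apply: eq_bigr => z _; rewrite [_ * (f z.+1 - _)]mulrC.
move=> <- h; have := subrr (\sum_(z < n.+1) wcol q l r z * g z * (kcol l r f z - f z)).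
rewrite -{1}h -!sumrB => h'; rewrite -[RHS]h'; apply: eq_bigr => z _; ring.
Qed.

(** Single-column core of the censoring inequality: the Dirichlet form of a decreasing and an
    increasing function is nonpositive. *)
Lemma wcol_dirichlet_ge l r (f g : nat -> R) : (forall y, (y < n)%N -> f y.+1 <= f y) -> nondec g ->
  \sum_(z < n.+1) wcol q l r z * f z * g z <=
  \sum_(z < n.+1) wcol q l r z * f z * kcol l r g z.
Proof.
move=> hf hg; rewrite -subr_ge0 -sumrB.
under eq_bigr do rewrite -mulrBr.
rewrite wcol_dirichlet oppr_ge0; apply: sumr_le0 => z _.
apply: mulr_ge0_le0.
  apply: mulr_ge0; first exact/ltW/wcol_gt0.
  by have /andP[] := cpp_bound l r z.
by apply: mulr_le0_ge0; rewrite ?subr_le0 ?subr_ge0; [exact: hf|exact: hg].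
Qed.

Lemma kcol1 l r y : kcol l r (fun=> 1) y = 1.
Proof. by rewrite /kcol; ring. Qed.

Variable tau : R.
Hypotheses (tau0 : 0 <= tau) (tau1 : tau <= 1).

(** Lazy version of the column chain; [tau] will be the probability [1 / n] that the site is
    picked. *)
Definition lcol (l r : nat) (u : nat -> R) (y : nat) : R :=
  (1 - tau) * u y + tau * kcol l r u y.

Lemma wcol_lcol_stat l r (u : nat -> R) :
  \sum_(z < n.+1) wcol q l r z * lcol l r u z = \sum_(z < n.+1) wcol q l r z * u z.
Proof.
have h : \sum_(z < n.+1) wcol q l r z * kcol l r u z = \sum_(z < n.+1) wcol q l r z * u z.
  have := wcol_reversible l r (fun=> 1) u.
  under eq_bigr do rewrite mulr1.
  by under [in X in _ = X -> _]eq_bigr do rewrite kcol1 mulr1.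
rewrite /lcol; under eq_bigr do rewrite mulrDr !(mulrCA (wcol _ _ _ _)).
by rewrite big_split -!mulr_sumr /= h; ring.
Qed.

(* Supersolution for the evolution of the discrete gradient of [kcol^t id]: a
   parabola between the neighbours, growing geometrically outside. *)
Definition env (W l r y : nat) : R :=
  let C0 := (W%:R + 1) / (1 - q) in
  if (y < minn l r)%N then C0 * q^-1 ^+ (minn l r - y)
  else if (y < maxn l r)%N then
    C0 + (y - minn l r)%:R * ((maxn l r).-1 - y)%:R
  else C0 * q^-1 ^+ (y.+1 - maxn l r).

Definition gapW (W : nat) : R := (1 - q) ^+ 2 / (4 * (W%:R + 1) ^+ 2).

Lemma gapW_ge0 W : 0 <= gapW W.
Proof. by rewrite divr_ge0 ?sqr_ge0 // mulr_ge0 ?sqr_ge0. Qed.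

Lemma gapW_le1 W : gapW W <= 1.
Proof.
have w1 : 1 <= W%:R + 1 :> R by rewrite lerDr.
rewrite ler_pdivrMr; last by rewrite mulr_gt0 // exprn_gt0 // (lt_le_trans ltr01).
rewrite mul1r (@le_trans _ _ 1) //.
  by apply: exprn_ile1; rewrite ?subr_ge0 ?gerBl ltW.
by have := exprn_ege1 2 w1; lra.
Qed.

Lemma env_ge1 W l r y : 1 <= env W l r y.
Proof.
have i1 : 1 <= q^-1 by rewrite invf_ge1 // ltW.
have c1 : 1 <= (W%:R + 1) / (1 - q).
  rewrite ler_pdivlMr ?subr_gt0 // mul1r.
  by have : 0 <= W%:R :> R by []; move: (ltW q0); lra.
rewrite /env; case: ifP => _; [|case: ifP => _].
- by rewrite mulr_ege1 // exprn_ege1.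
- by rewrite (le_trans c1) // lerDl mulr_ge0.
- by rewrite mulr_ege1 // exprn_ege1.
Qed.

Lemma gapW_tail W : gapW W <= (1 - q) ^+ 2 / 4.
Proof.
have w1 : 1 <= (W%:R + 1) ^+ 2 :> R by rewrite exprn_ege1 // lerDr.
have w0 : 0 < (W%:R + 1) ^+ 2 :> R by apply: lt_le_trans w1.
rewrite /gapW; move: ((_ + 1) ^+ 2) w0 w1 => X w0 w1.
by apply: ler_wpM2l; [exact: sqr_ge0|rewrite lef_pV2 ?posrE; lra].
Qed.

Lemma gapW_middle W : gapW W * ((W%:R + 1) / (1 - q) + W%:R ^+ 2) <= 2^-1.
Proof.
have w0 : 0 <= W%:R :> R by [].
have p0 : 0 < 1 - q by rewrite subr_gt0.
have h : (W%:R + 1) / (1 - q) + W%:R ^+ 2 <= (W%:R + 1) ^+ 2 / (1 - q).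
  rewrite ler_pdivlMr // mulrDl divfK ?gt_eqF //.
  have : W%:R ^+ 2 * (1 - q) <= W%:R ^+ 2 by rewrite ler_piMr ?sqr_ge0 // gerBl ltW.
  by move=> ?; lra.
apply: le_trans (ler_wpM2l (gapW_ge0 W) h) _.
have -> : gapW W * ((W%:R + 1) ^+ 2 / (1 - q)) = (1 - q) / 4.
  by rewrite /gapW; field; rewrite !gt_eqF //= ltr_wpDl.
by move: q0 => ?; lra.
Qed.

Lemma env_lo W l r z : (z < minn l r)%N ->
  env W l r z = (W%:R + 1) / (1 - q) * q^-1 ^+ (minn l r - z).
Proof. by rewrite /env => ->. Qed.

Lemma env_mid W l r z : (minn l r <= z < maxn l r)%N ->
  env W l r z = (W%:R + 1) / (1 - q) + (z - minn l r)%:R * ((maxn l r).-1 - z)%:R.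
Proof. by move=> /andP[h1 h2]; rewrite /env ltnNge h1 h2. Qed.

Lemma env_hi W l r z : (maxn l r <= z)%N ->
  env W l r z = (W%:R + 1) / (1 - q) * q^-1 ^+ (z.+1 - maxn l r).
Proof.
move=> h; have h1 : (z < maxn l r)%N = false by rewrite ltnNge h.
have h2 : (z < minn l r)%N = false.
  by rewrite ltnNge (leq_trans _ h) // (leq_trans (geq_minl l r) (leq_maxl l r)).
by rewrite /env h1 h2.
Qed.

(** Between the neighbours the second difference of the parabola is [-2], so rates [1/4] lower it by
    [1/2], which exceeds [gapW W * env]. Outside, successive values have ratio [q], which gives the
    factor [1 - (1 - q) ^ 2 / 4]. At the junctions the slack [C0 * (1 - q) = W + 1] pays for the
    slope of the parabola. The value [0] at [y = 0] reflects that there is no edge below height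
    [0]. *)
Lemma env_step W l r y :
  (maxn l r - minn l r <= W)%N ->
  (1 - cpm l r y.+1 - cpp l r y) * env W l r y
    + cpp l r y.+1 * env W l r y.+1
    + cpm l r y * (if y is y'.+1 then env W l r y' else 0)
  <= (1 - gapW W) * env W l r y.
Proof.
have := gapW_middle W; have := gapW_tail W; have := gapW_ge0 W.
have : 0 <= W%:R :> R by [].
set k := gapW W; set C0 := (W%:R + 1) / (1 - q); move=> w0 k0 kt km baW.
have p0 : 0 < 1 - q by rewrite subr_gt0.
have HC : C0 * (1 - q) = W%:R + 1 by rewrite divfK // gt_eqF.
have C00 : 0 < C0 by rewrite divr_gt0 // ltr_wpDl.
have qi : q * q^-1 = 1 by rewrite divff // gt_eqF.
have i0 : 0 < q^-1 by rewrite invr_gt0.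
have qC : q * C0 <= C0 by rewrite ler_piMl // ltW.
pose E := env W l r; rewrite -!/(E _).
pose Ep z := if z is z'.+1 then E z' else 0; rewrite -/(Ep y).
have E0 z : 0 <= E z by apply: le_trans (env_ge1 W l r z).
have Elo z : (z < minn l r)%N -> E z = C0 * q^-1 ^+ (minn l r - z).
  exact: env_lo.
have Emid z : (minn l r <= z < maxn l r)%N ->
    E z = C0 + (z - minn l r)%:R * ((maxn l r).-1 - z)%:R.
  exact: env_mid.
have Ehi z : (maxn l r <= z)%N -> E z = C0 * q^-1 ^+ (z.+1 - maxn l r).
  exact: env_hi.
have ab : (minn l r <= maxn l r)%N := leq_trans (geq_minl l r) (leq_maxl l r).
rewrite /cpm /cpp; move: (minn l r) (maxn l r) ab baW Elo Emid Ehi => a b ab baW Elo Emid Ehi.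
have tail (X Y : R) : X <= q / 4 * E y -> Y <= q / 4 * E y ->
    (1 - q ^+ 2 / 4 - 1 / 4) * E y + X + Y <= (1 - k) * E y.
  move=> hX hY; have : k * E y <= (1 - q) ^+ 2 / 4 * E y by rewrite ler_wpM2r.
  by move=> ?; lra.
have Elo1 z : (z < a)%N -> q * E z = C0 * q^-1 ^+ (a - z.+1).
  by move=> za; rewrite Elo // -(subnSK za) exprS mulrCA [q * (_ * _)]mulrA qi mul1r.
have Ehi1 z : (b <= z)%N -> q * E z = C0 * q^-1 ^+ (z - b).
  by move=> bz; rewrite Ehi // subSn // exprS mulrCA [q * (_ * _)]mulrA qi mul1r.
have [ya|ay] := ltnP y a.
  have -> : (y <= a)%N by exact: ltnW.
  have -> : (b <= y)%N = false by clear - ya ab; lia.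
  apply: tail.
    have h := Elo1 _ ya; have [ya1|ay1] := ltnP y.+1 a.
      have -> : (b <= y.+1)%N = false by clear - ya1 ab; lia.
      by rewrite Elo // -h; lra.
    have e1 : a = y.+1 by clear - ya ay1; lia.
    rewrite e1 subnn expr0 mulr1 in h; have [yb1|by1] := ltnP y.+1 b.
      by rewrite Emid ?e1 ?leqnn // subnn mul0r addr0; lra.
    have h2 := Ehi1 _ by1; rewrite (_ : y.+1 - b = 0)%N in h2; last by clear - ab e1; lia.
    have -> : q ^+ 2 / 4 * E y.+1 = q * (q * E y.+1) / 4 by ring.
    by move: h2; rewrite expr0 mulr1 => ->; lra.
  rewrite /Ep; case: y ya => [|y] ya; first by rewrite mulr0 mulr_ge0 // divr_ge0 // ltW.
  have := Elo1 _ (ltnW ya); rewrite -Elo // => h; rewrite -h.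
  have -> : q ^+ 2 / 4 * E y = q / 4 * (q * E y) by ring.
  by rewrite h.
have [yb|by_] := ltnP y b; last first.
  have -> : (b <= y.+1)%N by exact: leqW.
  rewrite /=.
  rewrite [1 - 1 / 4 - _]addrAC; apply: tail.
    have h : q * E y.+1 = E y by rewrite Ehi1 ?leqW // Ehi.
    have -> : q ^+ 2 / 4 * E y.+1 = q / 4 * (q * E y.+1) by ring.
    by rewrite h.
  rewrite /Ep; case: y ay by_ => [|y] ay by_; first by rewrite mulr0 mulr_ge0 // divr_ge0 // ltW.
  have [yb1|yb1] := leqP b y.
    rewrite ifF; last by clear - yb1 ab; lia.
    by have := Ehi1 _ by_; rewrite -Ehi //= => h; lra.
  have e1 : b = y.+1 by clear - by_ yb1; lia.
  have h := Ehi1 _ by_; rewrite e1 subnn expr0 mulr1 in h.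
  have [ya1|ya1] := leqP a y.
    by rewrite Emid ?ya1 ?e1 ?leqnn //= subnn mulr0 addr0; lra.
  have := Elo1 _ ya1; have -> : (a - y.+1 = 0)%N by clear - ab e1; lia.
  rewrite expr0 mulr1 => h2.
  have -> : q ^+ 2 / 4 * E y = q * (q * E y) / 4 by ring.
  by rewrite h2; lra.
rewrite /=.
have hE : k * E y <= 2^-1.
  apply: le_trans km; apply: ler_wpM2l => //; rewrite Emid ?ay // lerD2l expr2.
  by rewrite ler_pM // ler_nat; clear - ay yb baW; lia.
have up : (if (b <= y.+1)%N then q ^+ 2 / 4 else 1 / 4) * E y.+1 <=
    (C0 + (y.+1 - a)%:R * (b%:R - y%:R - 2)) / 4.
  case: ifP => [b1|/negbT]; last first.
    rewrite -ltnNge => b1; rewrite Emid ?b1 ?(leq_trans ay) //.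
    rewrite -natrB 1?ltnW // -natrB; last by clear - b1; lia.
    by rewrite (_ : b - y - 2 = b.-1 - y.+1)%N; [lra|clear - b1; lia].
  have e1 : b = y.+1 by clear - b1 yb; lia.
  have := Ehi1 _ b1; rewrite e1 subnn expr0 mulr1 => h.
  have -> : q ^+ 2 / 4 * E y.+1 = q * C0 / 4 by rewrite -h; ring.
  have : (y.+1 - a)%:R <= W%:R :> R by rewrite ler_nat -e1.
  by rewrite -(natr1 y); move: HC; lra.
have dn : (if (y <= a)%N then q ^+ 2 / 4 else 1 / 4)
      * Ep y <=
    (C0 + (y%:R - a%:R - 1) * (b - y)%:R) / 4.
  case: ifP => [b1|/negbT]; last first.
    rewrite -ltnNge /Ep; case: (y) ay yb => [//|z] ay yb b1.
    rewrite Emid ?(ltnW yb) ?andbT //.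
    have -> : z.+1%:R - a%:R - 1 = (z - a)%:R :> R by rewrite natrB // -(natr1 z); ring.
    by rewrite (_ : b.-1 - z = b - z.+1)%N; [lra|clear - yb; lia].
  have e1 : a = y by clear - b1 ay; lia.
  have bW : (b - y)%:R <= W%:R :> R by rewrite ler_nat -e1.
  have : q ^+ 2 / 4 * Ep y <= q * C0 / 4.
    rewrite /Ep; case: (y) e1 => [|z] e1; first by rewrite mulr0 divr_ge0 // mulr_ge0 // ltW.
    have := Elo1 z; rewrite e1 subnn expr0 mulr1 => <- //; lra.
  by rewrite e1; move: HC; lra.
have := Emid y; rewrite ay yb => /(_ isT) Ey.
have yb' : (b.-1 - y)%:R = b%:R - y%:R - 1 :> R.
  have -> : b%:R = ((b.-1 - y) + y).+1%:R :> R by congr (_%:R); clear - yb; lia.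
  by rewrite -(natr1 (_ + y)) natrD; ring.
have ya' : (y.+1 - a)%:R = (y - a)%:R + 1 :> R by rewrite subSn // natr1.
have ya2 : (y - a)%:R = y%:R - a%:R :> R by rewrite natrB.
have yb2 : (b - y)%:R = b%:R - y%:R :> R by rewrite natrB // ltnW.
move: up dn hE Ey; rewrite ya' yb' ya2 yb2.
move: (_ * E y.+1) (_ * Ep y) => X Y hX hY hE EE.
have -> : (1 - k) * E y = E y - k * E y by ring.
by move: (k * E y) hE => Z hE; rewrite EE; lra.
Qed.

End ColumnChain.

(** * Relaxation of the mean height of one column *)

Section ColumnRelax.
Variables (R : realFieldType) (q : R) (n : nat) (tau : R).
Hypotheses (q0 : 0 < q) (q1 : q < 1) (tau0 : 0 <= tau) (tau1 : tau <= 1).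

Lemma lcol_nondec l r u : nondec n u -> nondec n (lcol q n tau l r u).
Proof.
move=> hu y yn; rewrite /lcol lerD // ler_wpM2l ?subr_ge0 //; first exact: hu.
by apply: kcol_nondec => //.
Qed.

(** Comparison principle: the gradient recursion has nonnegative coefficients, so a multiple of the
    supersolution remains an upper bound. *)
Lemma lcol_env W l r (u : nat -> R) (c : R) : (maxn l r - minn l r <= W)%N ->
  0 <= c -> nondec n u -> (forall y, (y < n)%N -> u y.+1 - u y <= c * env q W l r y) ->
  forall y, (y < n)%N -> lcol q n tau l r u y.+1 - lcol q n tau l r u y
    <= c * (1 - tau * gapW q W) * env q W l r y.
Proof.
move=> hW c0 hu hD y yn.
have /andP[_ m1] := cpm_bound q0 q1 l r y.+1; have /andP[_ p1] := cpp_bound q0 q1 l r y.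
have /andP[m0 _] := cpm_bound q0 q1 l r y; have /andP[p0 _] := cpp_bound q0 q1 l r y.+1.
have e0 z : 0 <= c * env q W l r z.
  by rewrite mulr_ge0 // (le_trans _ (env_ge1 q0 q1 W l r z)).
have K : kcol q n l r u y.+1 - kcol q n l r u y <= c * ((1 - gapW q W) * env q W l r y).
  rewrite kcol_diff //; apply: le_trans (ler_wpM2l c0 (env_step q0 q1 y hW)).
  rewrite [c * _]mulrDr [c * (_ + _)]mulrDr; apply: lerD; first apply: lerD.
  - by rewrite mulrCA ler_wpM2l ?hD //; lra.
  - rewrite mulrCA ler_wpM2l //; have [yn2|yn2] := leqP y.+2 n.
      exact: hD.
    have -> : u n = u y.+1 by congr u; clear - yn yn2; lia.
    by rewrite subrr.
  - rewrite mulrCA ler_wpM2l //; case: (y) yn => [|z] zn; first by rewrite subrr mulr0.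
    by apply: hD; exact: ltnW.
have -> : c * (1 - tau * gapW q W) * env q W l r y =
  (1 - tau) * (c * env q W l r y) + tau * (c * ((1 - gapW q W) * env q W l r y)) by ring.
have := ler_wpM2l tau0 K; have t1 : 0 <= 1 - tau by rewrite subr_ge0.
have := ler_wpM2l t1 (hD y yn); rewrite /lcol; lra.
Qed.

(** Expected height after [T] lazy steps, as a function of the starting height. *)
Definition col_iter l r T : nat -> R := iter T (lcol q n tau l r) (fun z => z%:R).

Lemma col_iter_nondec l r T : nondec n (col_iter l r T).
Proof.
elim: T => [|T IH] /=; first by move=> y _; rewrite ler_nat.
exact: lcol_nondec.
Qed.

Lemma contr_ge0 W : 0 <= 1 - tau * gapW q W.
Proof.
by rewrite subr_ge0 mulr_ile1 ?gapW_ge0 ?gapW_le1.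
Qed.

Lemma col_iter_env W l r T : (maxn l r - minn l r <= W)%N ->
  forall y, (y < n)%N -> col_iter l r T y.+1 - col_iter l r T y
    <= (1 - tau * gapW q W) ^+ T * env q W l r y.
Proof.
move=> hW; elim: T => [|T IH] y yn /=.
  by rewrite expr0 mul1r -natr1 addrAC subrr add0r env_ge1.
rewrite exprSr; apply: lcol_env => //; first by rewrite exprn_ge0 // contr_ge0.
exact: col_iter_nondec.
Qed.

Lemma col_iter_stat l r T :
  \sum_(z < n.+1) wcol q l r z * col_iter l r T z = \sum_(z < n.+1) wcol q l r z * z%:R.
Proof. by elim: T => [//|T IH] /=; rewrite wcol_lcol_stat. Qed.

Definition relax_const (W L : nat) : R :=
  ((W%:R + 1) / (1 - q) + W%:R ^+ 2) * q^-1 ^+ L.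

(** Only edges at or above [y] occur. Below the neighbours the envelope has grown by at most [q^-L],
    since [y] lies at most [L] under the lower one. Above them the weight decays like [q ^ (2 m)],
    and one factor [q ^ m] absorbs the growth of the envelope. *)
Lemma wcol_env_le W L l r y x z : (maxn l r - minn l r <= W)%N ->
  (maxn l r <= n)%N -> (minn l r <= y + L)%N -> (y <= x < z)%N -> (z <= n)%N ->
  wcol q l r z * env q W l r x <= wcol_mass q n l r * relax_const W L.
Proof.
move=> hW bn aL /andP[yx xz] zn.
have p0 : 0 < 1 - q by rewrite subr_gt0.
have i1 : 1 <= q^-1 by rewrite invf_ge1 // ltW.
have qi0 : 0 <= q^-1 by rewrite invr_ge0 ltW.
have C0 : 0 <= (W%:R + 1) / (1 - q) by rewrite divr_ge0 ?(ltW p0) // addr_ge0.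
have wmass t : (t <= n)%N -> wcol q l r t <= wcol_mass q n l r.
  move=> tn; rewrite /wcol_mass (bigD1 (Ordinal (tn : (t < n.+1)%N))) //= lerDl.
  by apply: sumr_ge0 => i _; exact/ltW/wcol_gt0.
have w0 t : 0 <= wcol q l r t by exact/ltW/wcol_gt0.
have m0 : 0 <= wcol_mass q n l r by exact/ltW/wcol_mass_gt0.
have L1 : 1 <= q^-1 ^+ L by exact: exprn_ege1.
set C := (W%:R + 1) / (1 - q) in C0 *.
suff h : wcol q l r z * env q W l r x <= wcol_mass q n l r * ((C + W%:R ^+ 2) * q^-1 ^+ L).
  by [].
have CL : C <= (C + W%:R ^+ 2) * q^-1 ^+ L.
  rewrite -[leLHS]mulr1; apply: ler_pM => //.
  by rewrite lerDl sqr_ge0.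
have [xa|ax] := ltnP x (minn l r).
  rewrite env_lo //; apply: ler_pM => //; [|exact: wmass|].
    by rewrite mulr_ge0 // exprn_ge0.
  apply: ler_pM => //; first by rewrite exprn_ge0.
    by rewrite lerDl sqr_ge0.
  by rewrite ler_weXn2l //; clear - aL yx; lia.
have [xb|bx] := ltnP x (maxn l r).
  rewrite env_mid ?ax // -/C; apply: ler_pM => //; [|exact: wmass|].
    by rewrite addr_ge0 // mulr_ge0.
  rewrite -[leLHS]mulr1; apply: ler_pM => //.
    by rewrite addr_ge0 // mulr_ge0.
  rewrite lerD2l expr2; apply: ler_pM => //; rewrite ler_nat; clear - ax xb hW; lia.
rewrite env_hi // -/C.
have -> : wcol q l r z = wcol q l r (maxn l r) * q ^+ (z - maxn l r) * q ^+ (z - maxn l r).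
  rewrite /wcol /kq -!exprD; congr (q ^+ _); rewrite /absdiff; clear - bx xz; lia.
set m := (z - maxn l r)%N.
have qm : q ^+ m * q^-1 ^+ m = 1 by rewrite -exprMn divff ?expr1n // gt_eqF.
have hm : q ^+ m * q^-1 ^+ (x.+1 - maxn l r) <= 1.
  rewrite -qm; apply: ler_wpM2l; first exact/exprn_ge0/ltW.
  by rewrite ler_weXn2l // /m leq_sub2r.
have qm1 : q ^+ m <= 1 by rewrite exprn_ile1 // ltW.
apply: (@le_trans _ _ (wcol q l r (maxn l r) * C)); last exact: ler_pM (wmass _ bn) CL.
have -> : wcol q l r (maxn l r) * q ^+ m * q ^+ m * (C * q^-1 ^+ (x.+1 - maxn l r)) =
  wcol q l r (maxn l r) * C * (q ^+ m * (q ^+ m * q^-1 ^+ (x.+1 - maxn l r))) by ring.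
have qm0 : 0 <= q ^+ m by exact/exprn_ge0/ltW.
apply: ler_piMr; first by rewrite mulr_ge0.
by apply: mulr_ile1 => //; rewrite mulr_ge0 // exprn_ge0.
Qed.

(** By stationarity the left side is the [wcol]-average of [col_iter l r T z - col_iter l r T y].
    Terms with [z <= y] are nonpositive by monotonicity, so no upper bound on [y] relative to the
    neighbours is required; the others telescope into gradients. *)
Lemma col_relax W L l r y T : (maxn l r - minn l r <= W)%N ->
  (maxn l r <= n)%N -> (minn l r <= y + L)%N -> (y <= n)%N ->
  colmean q n l r - col_iter l r T y <=
    (1 - tau * gapW q W) ^+ T * ((n%:R + 1) * n%:R * relax_const W L).
Proof.
move=> hW bn aL yn; have M0 := wcol_mass_gt0 n q0 l r.
set P := (1 - _) ^+ T; set B := relax_const W L.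
have P0 : 0 <= P by rewrite exprn_ge0 // contr_ge0.
have p0 : 0 < 1 - q by rewrite subr_gt0.
have B0 : 0 <= B.
  rewrite mulr_ge0 ?exprn_ge0 ?invr_ge0 ?(ltW q0) // addr_ge0 ?sqr_ge0 //.
  by rewrite divr_ge0 ?(ltW p0) // addr_ge0.
rewrite -(ler_pM2r M0) mulrBl /colmean divfK ?gt_eqF // -(col_iter_stat l r T).
rewrite {1}/wcol_mass mulr_sumr -sumrB.
have term (z : 'I_n.+1) :
    wcol q l r z * col_iter l r T z - col_iter l r T y * wcol q l r z
    <= n%:R * (P * (wcol_mass q n l r * B)).
  have zn : (z <= n)%N by rewrite -ltnS.
  rewrite [col_iter l r T y * _]mulrC -mulrBr.
  have [zy|yz] := leqP z y.
    apply: (@le_trans _ _ 0); last first.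
      by apply: mulr_ge0 => //; apply: mulr_ge0 => //; apply: mulr_ge0 => //; exact: ltW.
    apply: mulr_ge0_le0; first exact/ltW/wcol_gt0.
    rewrite subr_le0.
    by apply: nondec_le; [exact: col_iter_nondec|rewrite zy].
  rewrite -(telescope_sumr _ (ltnW yz)) mulr_sumr.
  apply: (@le_trans _ _ (\sum_(y <= x < z) P * (wcol_mass q n l r * B))).
    rewrite big_nat [leRHS]big_nat; apply: ler_sum => x hx.
    have /andP[yx xz] := hx.
    apply: le_trans (ler_wpM2l (ltW (wcol_gt0 q0 l r z)) (col_iter_env T hW _)) _.
      exact: leq_trans xz zn.
    by rewrite mulrCA ler_wpM2l // (wcol_env_le hW bn aL hx zn).
  rewrite sumr_const_nat -[leLHS]mulr_natl ler_wpM2r ?ler_nat //.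
    by apply: mulr_ge0 => //; apply: mulr_ge0 => //; exact: ltW.
  by clear - zn; lia.
apply: le_trans (ler_sum _ (fun z _ => term z)) _.
rewrite sumr_const card_ord -[leLHS]mulr_natl -natr1 le_eqVlt; apply/orP; left.
by apply/eqP; ring.
Qed.

End ColumnRelax.

(** * Configurations, their partial order and single-column changes *)

Section Configurations.
Variable n : nat.
Implicit Types (eta : config n) (i : 'I_n) (z : 'I_n.+1).

Lemma hgt0 eta : hgt eta 0 = 0%N. Proof. by []. Qed.

Lemma hgt_site eta i : hgt eta i.+1 = eta i.
Proof. by rewrite /hgt /= valK. Qed.

Lemma hgt_end eta : hgt eta n.+1 = 0%N.
Proof. by rewrite /hgt /= insubF ?ltnn. Qed.

Lemma hgt_le eta j : (hgt eta j <= n)%N.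
Proof.
rewrite /hgt; case: ifP => // _; case: insubP => //= i _ _.
by rewrite -ltnS.
Qed.

Lemma hgt_setsite eta i z j :
  hgt (setsite eta i z) j = if j == i.+1 then z : nat else hgt eta j.
Proof.
case: j => [|j]; rewrite /hgt //= eqSS; case: insubP => [k _ <-|] /=.
  by rewrite ffunE -val_eqE; case: ifP.
by case: (j =P i :> nat) => // -> /negP[].
Qed.

Lemma hgt_setsite_neq eta i z j : j != i.+1 -> hgt (setsite eta i z) j = hgt eta j.
Proof. by rewrite hgt_setsite => /negbTE ->. Qed.

Lemma hgt_setsite_l eta i z : hgt (setsite eta i z) i = hgt eta i.
Proof. by rewrite hgt_setsite_neq // neq_ltn ltnSn. Qed.

Lemma hgt_setsite_r eta i z : hgt (setsite eta i z) i.+2 = hgt eta i.+2.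
Proof. by rewrite hgt_setsite_neq // neq_ltn ltnSn orbT. Qed.

Lemma setsite_id eta i : setsite eta i (eta i) = eta.
Proof. by apply/ffunP => k; rewrite ffunE; case: eqP => [->|]. Qed.

Lemma setsite_at eta i z : setsite eta i z i = z.
Proof. by rewrite ffunE eqxx. Qed.

Lemma setsite_setsite eta i z z' : setsite (setsite eta i z) i z' = setsite eta i z'.
Proof. by apply/ffunP => k; rewrite !ffunE; case: (k == i). Qed.

(** The swap of a free value [z] with the value of column [i] is an involution on pairs, so
    resampling a column counts every configuration [n + 1] times. *)
Lemma colsum (R : pzSemiRingType) (G : config n -> R) i :
  \sum_eta \sum_(z < n.+1) G (setsite eta i z) = n.+1%:R * \sum_eta G eta.
Proof.
pose h (p : config n * 'I_n.+1) := (setsite p.1 i p.2, p.1 i).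
have hK : involutive h.
  by move=> [eta z]; rewrite /h /= setsite_setsite setsite_at setsite_id.
rewrite pair_bigA (reindex_inj (inv_inj hK)) /=.
under eq_bigr do rewrite setsite_setsite setsite_id.
rewrite -(pair_bigA _ (fun eta z => G eta)) /= mulr_sumr.
by apply: eq_bigr => eta _; rewrite sumr_const card_ord mulr_natl.
Qed.

Definition cle eta eta' := forall i, (eta i <= eta' i)%N.

Lemma cle_hgt eta eta' j : cle eta eta' -> (hgt eta j <= hgt eta' j)%N.
Proof. by move=> h; rewrite /hgt; case: ifP => // _; case: insubP => //= k _ _; exact: h. Qed.

Lemma cle_setsite eta eta' i z z' :
  cle eta eta' -> (z <= z')%N -> cle (setsite eta i z) (setsite eta' i z').
Proof. by move=> h zz k; rewrite !ffunE; case: (k == i) => //; exact: h. Qed.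

Section Functions.
Variable R : realType.
Implicit Types f g : config n -> R.

Definition inc f := forall eta eta', cle eta eta' -> f eta <= f eta'.
Definition dec f := forall eta eta', cle eta eta' -> f eta' <= f eta.

Lemma inc_oppr f : dec f -> inc (fun eta => - f eta).
Proof. by move=> h eta eta' /h; rewrite lerN2. Qed.

Definition colfun f eta i : nat -> R := fun y => f (setsite eta i (inord y)).

Lemma colfun_at f eta i : colfun f eta i (eta i) = f eta.
Proof. by rewrite /colfun inord_val setsite_id. Qed.

Lemma colfun_ord f eta i z : colfun f eta i z = f (setsite eta i z).
Proof. by rewrite /colfun inord_val. Qed.

Lemma colfun_setsite f eta i z : colfun f (setsite eta i z) i = colfun f eta i.
Proof. by apply: boolp.funext => y; rewrite /colfun setsite_setsite. Qed.

Lemma colfun_inc f eta i : inc f -> nondec n (colfun f eta i).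
Proof.
move=> hf y yn; apply: hf; apply: cle_setsite => //.
by rewrite !inordK // ltnS // ltnW.
Qed.

End Functions.
End Configurations.

(** * Equilibrium expectations and the update operators *)

Section Dynamics.
Variables (R : realType) (beta : R) (n : nat).
Hypothesis hbeta : 0 < beta.
Local Notation q := (expR (- beta)).
Implicit Types (eta : config n) (i : 'I_n) (z : 'I_n.+1) (f g : config n -> R).

Lemma q_gt0 : 0 < q. Proof. exact: expR_gt0. Qed.

Lemma q_lt1 : q < 1. Proof. by rewrite expR_lt1 oppr_lt0. Qed.

Let q0 := q_gt0.
Let q1 := q_lt1.

Lemma weight_edges eta :
  weight beta eta = \prod_(j < n.+1) kq q (hgt eta j) (hgt eta j.+1).
Proof.
by rewrite /weight /energy /kq -expr_sum -expRM_natr mulNr.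
Qed.

Lemma weight_gt0 eta : 0 < weight beta eta.
Proof. exact: expR_gt0. Qed.

Lemma partZ_gt0 : 0 < partZ beta n.
Proof.
rewrite /partZ (bigD1 [ffun=> ord0]) //= ltr_pwDl ?weight_gt0 //.
by apply: sumr_ge0 => eta _; exact/ltW/weight_gt0.
Qed.

Lemma mu_gt0 eta : 0 < mu beta eta.
Proof. by rewrite divr_gt0 ?weight_gt0 ?partZ_gt0. Qed.

(** Site [i] sits at position [i + 1], so the two edges that touch it have indices [i] and
    [i + 1]. *)
Definition offcol eta i : R :=
  \prod_(j < n.+1 | (j != i :> nat) && (j != i.+1 :> nat)) kq q (hgt eta j) (hgt eta j.+1).

Lemma weight_setsite eta i z : weight beta (setsite eta i z) =
  offcol eta i * wcol q (hgt eta i) (hgt eta i.+2) z.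
Proof.
have iP : (i < n.+1)%N by exact: leqW.
rewrite weight_edges (bigD1 (Ordinal iP)) //=.
rewrite (bigD1 (Ordinal (ltn_ord i : (i.+1 < n.+1)%N))) /=; last first.
  by rewrite -val_eqE /= neq_ltn ltnSn orbT.
rewrite hgt_setsite_l hgt_setsite_r hgt_setsite eqxx mulrA mulrC; congr (_ * _).
apply: eq_big => [j|j]; first by rewrite -!val_eqE.
rewrite -!val_eqE /= => /andP[h1 h2]; by rewrite !hgt_setsite_neq.
Qed.

Definition Emu f : R := \sum_eta mu beta eta * f eta.

(** Conditioning on all columns but one; it reduces statements about an update at [i] to the
    single-column chain. *)
Lemma Emu_col f i : Emu f = (n.+1%:R * partZ beta n)^-1 *
  \sum_eta offcol eta i *
    \sum_(z < n.+1) wcol q (hgt eta i) (hgt eta i.+2) z * colfun f eta i z.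
Proof.
have -> : \sum_eta offcol eta i *
    \sum_(z < n.+1) wcol q (hgt eta i) (hgt eta i.+2) z * colfun f eta i z =
  \sum_eta \sum_(z < n.+1) weight beta (setsite eta i z) * f (setsite eta i z).
  apply: eq_bigr => eta _; rewrite mulr_sumr; apply: eq_bigr => z _.
  by rewrite weight_setsite colfun_ord mulrA.
rewrite (colsum (fun eta => weight beta eta * f eta)) invfM mulrACA.
rewrite mulVf ?mul1r ?pnatr_eq0 // /Emu mulrC mulr_suml.
by apply: eq_bigr => eta _; rewrite /mu mulrAC.
Qed.

Lemma Emu_cst c : Emu (fun=> c) = c.
Proof. by rewrite /Emu -mulr_suml /mu -mulr_suml divff ?mul1r // gt_eqF ?partZ_gt0. Qed.

Lemma Emu_le f g : (forall eta, f eta <= g eta) -> Emu f <= Emu g.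
Proof. by move=> h; apply: ler_sum => eta _; rewrite ler_wpM2l ?h // ltW // mu_gt0. Qed.

Lemma EmuD f g : Emu (fun eta => f eta + g eta) = Emu f + Emu g.
Proof. by rewrite /Emu -big_split; apply: eq_bigr => eta _; rewrite mulrDr. Qed.

Lemma EmuZ c f : Emu (fun eta => c * f eta) = c * Emu f.
Proof. by rewrite /Emu mulr_sumr; apply: eq_bigr => eta _; rewrite mulrCA. Qed.

Lemma EmuB f g : Emu (fun eta => f eta - g eta) = Emu f - Emu g.
Proof. by rewrite /Emu -sumrB; apply: eq_bigr => eta _; rewrite mulrBr. Qed.

Lemma Emu_sum (I : finType) (F : I -> config n -> R) :
  Emu (fun eta => \sum_k F k eta) = \sum_k Emu (F k).
Proof. by rewrite /Emu exchange_big; apply: eq_bigr => eta _; rewrite mulr_sumr. Qed.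

Lemma eq_Emu f g : f =1 g -> Emu f = Emu g.
Proof. by move=> h; apply: eq_bigr => eta _; rewrite h. Qed.

Definition site_op i f eta : R :=
  pminus beta eta i * f (Defs.down eta i) + pplus beta eta i * f (Defs.up eta i)
  + (1 - pminus beta eta i - pplus beta eta i) * f eta.

Lemma sqr_q : q ^+ 2 = expR (- (2 * beta)).
Proof. by rewrite -expRM_natl mulrN. Qed.

Lemma site_opE i f eta :
  site_op i f eta = kcol q n (hgt eta i) (hgt eta i.+2) (colfun f eta i) (eta i).
Proof.
rewrite /kcol colfun_at /site_op.
have -> : pminus beta eta i = cpm q (hgt eta i) (hgt eta i.+2) (eta i).
  by rewrite /pminus /cpm sqr_q.
by have -> : pplus beta eta i = cpp q (hgt eta i) (hgt eta i.+2) (eta i)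
  by rewrite /pplus /cpp sqr_q.
Qed.

Lemma site_op_col i f eta (y : nat) : (y <= n)%N ->
  colfun (site_op i f) eta i y = kcol q n (hgt eta i) (hgt eta i.+2) (colfun f eta i) y.
Proof.
move=> yn; rewrite {1}/colfun site_opE hgt_setsite_l hgt_setsite_r colfun_setsite.
by rewrite setsite_at inordK.
Qed.

Lemma site_op_selfadj i f g :
  Emu (fun eta => f eta * site_op i g eta) = Emu (fun eta => site_op i f eta * g eta).
Proof.
rewrite !(Emu_col _ i); congr (_ * _); apply: eq_bigr => eta _; congr (_ * _).
transitivity (\sum_(z < n.+1) wcol q (hgt eta i) (hgt eta i.+2) z * colfun f eta i z *
    kcol q n (hgt eta i) (hgt eta i.+2) (colfun g eta i) z).
  by apply: eq_bigr => z _; rewrite -mulrA -site_op_col // -ltnS.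
rewrite wcol_reversible //; apply: eq_bigr => z _.
by rewrite -mulrA -site_op_col // -ltnS.
Qed.

Lemma offcol_ge0 eta i : 0 <= offcol eta i.
Proof. by apply: prodr_ge0 => j _; exact/ltW/kq_gt0. Qed.

(** Column by column this is [wcol_dirichlet_ge]; it is the censoring inequality for a single
    update. *)
Lemma Emu_site_op_ge i f g : dec f -> inc g ->
  Emu (fun eta => f eta * g eta) <= Emu (fun eta => f eta * site_op i g eta).
Proof.
move=> hf hg; rewrite !(Emu_col _ i) ler_wpM2l //.
  by rewrite invr_ge0 mulr_ge0 // ltW // partZ_gt0.
apply: ler_sum => eta _; rewrite ler_wpM2l ?offcol_ge0 //.
apply: (@le_trans _ _ (\sum_(z < n.+1) wcol q (hgt eta i) (hgt eta i.+2) z *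
    colfun f eta i z * colfun g eta i z)).
  by apply: ler_sum => z _; rewrite mulrA.
apply: (le_trans (wcol_dirichlet_ge _ _ _ _ _ _)) => //.
- move=> y yn; have := colfun_inc eta i (inc_oppr hf) yn.
  by rewrite /colfun lerN2.
- exact: colfun_inc.
by apply: ler_sum => z _; rewrite -mulrA -site_op_col // -ltnS.
Qed.

(** Attractiveness, in three comparisons: raise the function through the other columns, then the
    neighbours in the rates, then the height of the column itself. *)
Lemma site_op_inc i f : inc f -> inc (site_op i f).
Proof.
move=> hf eta eta' h; rewrite !site_opE.
have yn : (eta i <= n)%N by rewrite -ltnS.
have yn' : (eta' i <= n)%N by rewrite -ltnS.
apply: (@le_trans _ _ (kcol q n (hgt eta i) (hgt eta i.+2) (colfun f eta' i) (eta i))).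
  by apply: kcol_le => // z zn; apply: hf; exact: cle_setsite.
apply: (@le_trans _ _ (kcol q n (hgt eta' i) (hgt eta' i.+2) (colfun f eta' i) (eta i))).
  apply: kcol_env => //; [exact: colfun_inc|exact: cle_hgt|exact: cle_hgt].
apply: (@nondec_le _ n); last by rewrite h.
apply: kcol_nondec => //; exact: colfun_inc.
Qed.

Lemma site_op_opp i f eta : site_op i (fun eta => - f eta) eta = - site_op i f eta.
Proof. by rewrite /site_op; ring. Qed.

Lemma site_op_cst i c eta : site_op i (fun=> c) eta = c.
Proof. by rewrite /site_op; ring. Qed.

Lemma site_op_le i f g : (forall eta, f eta <= g eta) ->
  forall eta, site_op i f eta <= site_op i g eta.
Proof.
move=> h eta; rewrite !site_opE; apply: kcol_le => // [|z zn]; last exact: h.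
by rewrite -ltnS.
Qed.

(* One step of the dynamics censored to the sites of [A]. *)
Definition cens_op (A : pred 'I_n) f eta : R :=
  n%:R^-1 * \sum_i (if A i then site_op i f eta else f eta).

Lemma cens_op_inc A f : inc f -> inc (cens_op A f).
Proof.
move=> hf eta eta' h; rewrite ler_wpM2l ?invr_ge0 //; apply: ler_sum => i _.
by case: ifP => _; [exact: site_op_inc|exact: hf].
Qed.

Lemma cens_op_dec A f : dec f -> dec (cens_op A f).
Proof.
move=> /inc_oppr /(cens_op_inc A) hf eta eta' /hf.
have E e : cens_op A (fun eta => - f eta) e = - cens_op A f e.
  rewrite /cens_op -mulrN -sumrN; congr (_ * _); apply: eq_bigr => i _.
  by case: ifP => // _; rewrite site_op_opp.
by rewrite !E lerN2.
Qed.

Lemma cens_op_le A f g : (forall eta, f eta <= g eta) ->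
  forall eta, cens_op A f eta <= cens_op A g eta.
Proof.
move=> h eta; rewrite ler_wpM2l ?invr_ge0 //; apply: ler_sum => i _.
by case: ifP => _ //; exact: site_op_le.
Qed.

Lemma Emu_cens_op A f g : Emu (fun eta => f eta * cens_op A g eta) =
  n%:R^-1 * \sum_i (if A i then Emu (fun eta => f eta * site_op i g eta)
                    else Emu (fun eta => f eta * g eta)).
Proof.
transitivity (n%:R^-1 * Emu (fun eta => \sum_i
    (if A i then f eta * site_op i g eta else f eta * g eta))).
  rewrite -EmuZ; apply: eq_Emu => eta; rewrite /cens_op mulrCA; congr (_ * _).
  by rewrite mulr_sumr; apply: eq_bigr => i _; case: ifP.
by rewrite Emu_sum; congr (_ * _); apply: eq_bigr => i _; case: ifP.
Qed.

Lemma cens_op_selfadj A f g :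
  Emu (fun eta => f eta * cens_op A g eta) = Emu (fun eta => cens_op A f eta * g eta).
Proof.
have -> : Emu (fun eta => cens_op A f eta * g eta) =
    Emu (fun eta => g eta * cens_op A f eta) by apply: eq_Emu => eta; exact: mulrC.
rewrite !Emu_cens_op; congr (_ * _); apply: eq_bigr => i _; case: ifP => _.
  by rewrite site_op_selfadj; apply: eq_Emu => eta; exact: mulrC.
by apply: eq_Emu => eta; exact: mulrC.
Qed.

Hypothesis n0 : (0 < n)%N.

Lemma cens_op_cst A c eta : cens_op A (fun=> c) eta = c.
Proof.
rewrite /cens_op; under eq_bigr do rewrite site_op_cst if_same.
by rewrite sumr_const card_ord -[c *+ n]mulr_natl mulKf // pnatr_eq0 -lt0n.
Qed.

Lemma Emu_cens_full A f g : dec f -> inc g ->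
  Emu (fun eta => f eta * cens_op A g eta) <= Emu (fun eta => f eta * cens_op predT g eta).
Proof.
move=> hf hg; rewrite !Emu_cens_op ler_wpM2l ?invr_ge0 //; apply: ler_sum => i _.
by case: ifP => // _; exact: Emu_site_op_ge.
Qed.

Lemma Emu_cens_stat A f : Emu (cens_op A f) = Emu f.
Proof.
have := cens_op_selfadj A (fun=> 1) f.
have -> : Emu (fun eta => 1 * cens_op A f eta) = Emu (cens_op A f).
  by apply: eq_Emu => eta; rewrite mul1r.
by move=> ->; apply: eq_Emu => eta; rewrite cens_op_cst mul1r.
Qed.

Lemma nuS_pairing t f : \sum_eta nu beta t.+1 eta * f eta =
  \sum_eta nu beta t eta * cens_op predT f eta.
Proof.
rewrite /=; under eq_bigr do rewrite mulr_suml.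
rewrite exchange_big; apply: eq_bigr => eta _ /=.
under eq_bigr do rewrite -mulrA.
rewrite -mulr_sumr; congr (_ * _); rewrite /trans.
under eq_bigr do rewrite mulr_suml.
rewrite exchange_big /cens_op mulr_sumr; apply: eq_bigr => i _ /=.
have D e : \sum_eta' (eta' == e)%:R * f eta' = f e.
  rewrite (bigD1 e) //= eqxx mul1r big1 ?addr0 // => e' /negbTE ->.
  by rewrite mul0r.
rewrite /site_op -(D (Defs.down eta i)) -(D (Defs.up eta i)) -[f eta]D !mulr_sumr -!big_split /=.
by rewrite mulr_sumr; apply: eq_bigr => e _; ring.
Qed.

End Dynamics.

(** * Densities of censored dynamics and total variation distance *)

Section Censoring.
Variables (R : realType) (beta : R) (n : nat).
Hypotheses (hbeta : 0 < beta) (n0 : (0 < n)%N).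
Implicit Types (eta : config n) (f g : config n -> R) (s : seq (pred 'I_n)).
Local Notation E := (Emu beta).

Lemma minconf_cle eta : cle (minconf n) eta.
Proof. by move=> i; rewrite ffunE. Qed.

Definition dens0 eta : R := (eta == minconf n)%:R / mu beta (minconf n).

Lemma Emu_dens0 f : E (fun eta => dens0 eta * f eta) = f (minconf n).
Proof.
rewrite /Emu (bigD1 (minconf n)) //= big1 => [|eta /negbTE h].
  by rewrite addr0 /dens0 eqxx mul1r mulVKf // gt_eqF // mu_gt0.
by rewrite /dens0 h !mul0r mulr0.
Qed.

(* Density with respect to [mu] of the censored dynamics; the list of update
   sets is read from right to left. *)
Definition cens_dens s : config n -> R := foldr (@cens_op R beta n) dens0 s.

Lemma cens_dens_dec s : dec (cens_dens s).
Proof.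
elim: s => [|A s IH] /=; last exact: cens_op_dec.
move=> eta eta' h; rewrite ler_wpM2r ?invr_ge0 ?(ltW (mu_gt0 _ _)) // ler_nat.
case: eqP => // e'; rewrite (_ : eta == minconf n) //; apply/eqP/ffunP => i.
apply/val_inj/eqP; rewrite eqn_leq; apply/andP; split; last exact: minconf_cle.
by rewrite -e'; exact: h.
Qed.

Lemma cens_dens_ge0 s eta : 0 <= cens_dens s eta.
Proof.
elim: s eta => [|A s IH] eta /=; first by rewrite divr_ge0 // ltW // mu_gt0.
by rewrite -(cens_op_cst beta n0 A 0 eta); exact: cens_op_le.
Qed.

Lemma Emu_cens_dens s : E (cens_dens s) = 1.
Proof.
elim: s => [|A s IH] /=; last by rewrite Emu_cens_stat.
have := Emu_dens0 (fun=> 1); under eq_Emu do rewrite mulr1.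
by [].
Qed.

(** Clear at time zero, where the mass sits at the minimum; each update is then moved onto [f],
    which stays increasing and keeps its equilibrium mean. *)
Lemma cens_dens_le_mu s f : inc f -> E (fun eta => cens_dens s eta * f eta) <= E f.
Proof.
elim: s f => [|A s IH] f hf /=.
  rewrite Emu_dens0 -(Emu_cst beta n (f (minconf n))); apply: Emu_le => eta.
  exact/hf/minconf_cle.
rewrite -cens_op_selfadj //; apply: le_trans (IH _ (cens_op_inc hbeta A hf)) _.
by rewrite Emu_cens_stat.
Qed.

(* Peres-Winkler: for a decreasing density, skipping updates only slows down
   the convergence towards [mu]. *)
Lemma cens_dens_le_nu s f : inc f ->
  E (fun eta => cens_dens s eta * f eta) <= \sum_eta nu beta (size s) eta * f eta.
Proof.
elim: s f => [|A s IH] f hf /=.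
  rewrite Emu_dens0 (bigD1 (minconf n)) //= eqxx mul1r lerDl sumr_ge0 // => eta.
  by move=> /negbTE ->; rewrite mul0r.
rewrite -[X in _ <= X]/(\sum_eta nu beta (size s).+1 eta * f eta) nuS_pairing //.
rewrite -cens_op_selfadj //; apply: (@le_trans _ _
  (E (fun eta => cens_dens s eta * cens_op beta predT f eta))).
  by apply: Emu_cens_full => //; exact: cens_dens_dec.
by apply: IH; exact: cens_op_inc.
Qed.

Lemma nu_pairing t f : \sum_eta nu beta t eta * f eta =
  E (fun eta => cens_dens (nseq t (predT : pred 'I_n)) eta * f eta).
Proof.
elim: t f => [|t IH] f.
  rewrite Emu_dens0 (bigD1 (minconf n)) //= eqxx mul1r big1 ?addr0 // => eta.
  by move=> /negbTE ->; rewrite mul0r.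
by rewrite nuS_pairing // IH /= cens_op_selfadj.
Qed.

(** By reversibility the density evolves under the same operator as the observables; the formula is
    read off from indicators of points. *)
Lemma nu_density t eta : nu beta t eta = mu beta eta * cens_dens (nseq t (predT : pred 'I_n)) eta.
Proof.
have := nu_pairing t (fun e => (e == eta)%:R).
rewrite /Emu (bigD1 eta) //= eqxx mulr1 big1 ?addr0 => [->|e /negbTE ->]; last first.
  by rewrite mulr0.
rewrite (bigD1 eta) //= eqxx mulr1 big1 ?addr0 // => e /negbTE ->.
by rewrite !mulr0.
Qed.

Lemma cle_sum eta eta' : cle eta eta' -> eta != eta' ->
  (\sum_(i < n) eta i < \sum_(i < n) eta' i)%N.
Proof.
move=> h /eqP ne; rewrite ltn_neqAle leq_sum // andbT; apply/eqP => e.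
apply: ne; apply/ffunP => i; apply/val_inj/eqP; rewrite eqn_leq h /= leqNgt.
apply/negP => lt; move: e; apply/eqP; rewrite neq_ltn; apply/orP; left.
rewrite (bigD1 i) //= [X in (_ < X)%N](bigD1 i) //= -addSn leq_add //.
by apply: leq_sum.
Qed.

(* The set where the density is below [1] is increasing, and [sum_i eta_i] minus
   its indicator is still an increasing function. *)
Lemma tv_le_heights s : tv_to_mu beta n (size s) <=
  \sum_(i < n) (E (fun eta => (hgt eta i.+1)%:R)
                - E (fun eta => cens_dens s eta * (hgt eta i.+1)%:R)).
Proof.
set t := size s; set g := cens_dens (nseq t (predT : pred 'I_n)).
pose B eta : R := (g eta < 1)%R%:R.
pose V eta : R := (\sum_(i < n) eta i)%:R.
have hg : dec g by exact: cens_dens_dec.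
have incV : inc (fun eta => V eta - B eta).
  move=> eta eta' h; have [->//|ne] := eqVneq eta eta'.
  have : V eta + 1 <= V eta' by rewrite /V natr1 ler_nat cle_sum.
  have : B eta' <= 1 by rewrite /B lern1 leq_b1.
  have : 0 <= B eta by [].
  by lra.
have tvE : tv_to_mu beta n t = E (fun eta => (1 - g eta) * B eta).
  have : E (fun eta => 1 - g eta) = 0 by rewrite EmuB Emu_cst Emu_cens_dens subrr.
  move=> h; suff key : \sum_(eta : config n) `|nu beta t eta - mu beta eta| =
      2 * E (fun eta => (1 - g eta) * B eta) by rewrite /tv_to_mu key mulKf.
  (* Adding the null mean of [1 - g] turns [|1 - g|] into twice its positive part. *)
  transitivity (\sum_(eta : config n) `|nu beta t eta - mu beta eta| + E (fun eta => 1 - g eta)).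
    by rewrite h addr0.
  rewrite /Emu mulr_sumr -big_split /=; apply: eq_bigr => eta _.
  rewrite nu_density -/g -[X in _ - X]mulr1 -mulrBr normrM gtr0_norm ?mu_gt0 //.
  rewrite /B; case: ltP => c.
    by rewrite ltr0_norm ?subr_lt0 //=; ring.
  by rewrite ger0_norm ?subr_ge0 //=; ring.
have le1 : E (fun eta => g eta * (V eta - B eta)) <= E (fun eta => V eta - B eta).
  exact: cens_dens_le_mu.
have -> : \sum_(i < n) (E (fun eta => (hgt eta i.+1)%:R)
      - E (fun eta => cens_dens s eta * (hgt eta i.+1)%:R)) =
    E V - E (fun eta => cens_dens s eta * V eta).
  rewrite sumrB -!Emu_sum; congr (_ - _); apply: eq_Emu => eta.
    by rewrite /V natr_sum; apply: eq_bigr => i _; rewrite hgt_site.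
  rewrite /V natr_sum mulr_sumr.
  by apply: eq_bigr => i _; rewrite hgt_site.
have le2 : E (fun eta => cens_dens s eta * V eta) <= E (fun eta => g eta * V eta).
  rewrite -nu_pairing; apply: cens_dens_le_nu => eta eta' h.
  by rewrite ler_nat leq_sum.
rewrite tvE.
have -> : E (fun eta => (1 - g eta) * B eta) = E B - E (fun eta => g eta * B eta).
  by rewrite -EmuB; apply: eq_Emu => eta; ring.
have e3 : E (fun eta => g eta * (V eta - B eta)) =
    E (fun eta => g eta * V eta) - E (fun eta => g eta * B eta).
  by rewrite -EmuB; apply: eq_Emu => eta; ring.
by move: le1 le2; rewrite e3 EmuB; lra.
Qed.

End Censoring.

(** * Steep edges are unlikely under a decreasing density *)

Section Gradient.
Variables (R : realType) (beta : R) (n : nat).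
Hypotheses (hbeta : 0 < beta).
Implicit Types (eta : config n) (i : 'I_n) (z : 'I_n.+1) (f g F G : config n -> R).
Local Notation E := (Emu beta).
Local Notation q := (expR (- beta)).
Let q0 : 0 < q := q_gt0 beta.
Let q1 : q < 1 := q_lt1 hbeta.

(* The weight of the first [k] columns, the remaining ones being summed out. *)
Definition pre_weight (k : nat) eta : R :=
  (\prod_(j < k) kq q (hgt eta j) (hgt eta j.+1)) * hitw q n (n - k) (hgt eta k).

Lemma pre_weight_ge0 k eta : 0 <= pre_weight k eta.
Proof.
by rewrite mulr_ge0 ?(ltW (hitw_gt0 _ _ _ _)) // prodr_ge0 // => j _; exact/ltW/kq_gt0.
Qed.

Lemma pre_weight_full eta : pre_weight n eta = weight beta eta.
Proof.
rewrite weight_edges big_ord_recr /= /pre_weight subnn hgt_end /hitw /= /kq.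
by rewrite /absdiff subn0 sub0n addn0.
Qed.

(** Average over the column at position [i + 1] under its conditional law given position [i], the
    columns further right having been summed out of the measure. *)
Definition heat i f eta : R :=
  (\sum_(z < n.+1) kq q (hgt eta i) z * hitw q n (n - i.+1) z * f (setsite eta i z))
  / hitw q n (n - i) (hgt eta i).

Lemma hitwS i x : hitw q n (n - i) x =
  \sum_(z < n.+1) kq q x z * hitw q n (n - i.+1) z.
Proof. by rewrite -(subnSK (ltn_ord i)). Qed.

(** The sum still ranges over the last [n - k] columns, which the weight ignores; the power of
    [n + 1] compensates for them. *)
Definition pre_exp (k : nat) f : R :=
  (\sum_eta pre_weight k eta * f eta) / (partZ beta n * n.+1%:R ^+ (n - k)).

Lemma pre_exp_full f : pre_exp n f = E f.
Proof.
rewrite /pre_exp subnn expr0 mulr1 mulr_suml; apply: eq_bigr => eta _.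
by rewrite pre_weight_full /mu mulrAC.
Qed.

Lemma pre_exp_heat i f : pre_exp i.+1 f = pre_exp i (heat i f).
Proof.
rewrite /pre_exp -[(n - i)%N](subnSK (ltn_ord i)) exprS mulrCA.
suff -> : \sum_eta pre_weight i eta * heat i f eta =
    n.+1%:R * \sum_eta pre_weight i.+1 eta * f eta.
  by rewrite -mulf_div divff ?mul1r // pnatr_eq0.
rewrite -(colsum (fun eta => pre_weight i.+1 eta * f eta) i).
apply: eq_bigr => eta _; rewrite /heat /pre_weight.
rewrite -mulrA [hitw _ _ _ _ * _]mulrC divfK ?gt_eqF ?hitw_gt0 // mulr_sumr.
apply: eq_bigr => z _; rewrite big_ord_recr /= hgt_setsite_l hgt_setsite eqxx.
rewrite -!mulrA; congr (_ * _); apply: eq_bigr => j _.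
by rewrite !hgt_setsite_neq // neq_ltn ?ltnS ?ltn_ord ?(ltnW (ltn_ord j)).
Qed.

Lemma pre_exp_le k f g : (forall eta, f eta <= g eta) -> pre_exp k f <= pre_exp k g.
Proof.
move=> h; rewrite ler_wpM2r ?invr_ge0 ?mulr_ge0 ?exprn_ge0 ?(ltW (partZ_gt0 _ _)) //.
by apply: ler_sum => eta _; rewrite ler_wpM2l ?pre_weight_ge0.
Qed.

Lemma pre_expZ k c f : pre_exp k (fun eta => c * f eta) = c * pre_exp k f.
Proof.
rewrite /pre_exp mulrA; congr (_ / _); rewrite mulr_sumr.
by apply: eq_bigr => eta _; rewrite mulrCA.
Qed.

(** Raising the columns on the left lowers [f] and, by total positivity, also shifts the conditional
    law of the averaged column upwards; both effects decrease the average. *)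
Lemma heat_dec i f : dec f -> dec (heat i f).
Proof.
move=> hf eta eta' h; set m := (n - i.+1)%N.
have H0 x : 0 < hitw q n (n - i) x by exact: hitw_gt0.
apply: (@le_trans _ _ ((\sum_(z < n.+1)
    kq q (hgt eta' i) z * hitw q n m z * f (setsite eta i z))
    / hitw q n (n - i) (hgt eta' i))).
  rewrite ler_pM2r ?invr_gt0 //; apply: ler_sum => z _.
  rewrite ler_wpM2l ?mulr_ge0 ?(ltW (kq_gt0 _ _ _)) ?(ltW (hitw_gt0 _ _ _ _)) //.
  by apply: hf; exact: cle_setsite.
rewrite ler_pdivrMr // mulrAC ler_pdivlMr // !hitwS -/m.
have := @mlr_sum R n.+1 (fun z => kq q (hgt eta i) z * hitw q n m z)
  (fun z => kq q (hgt eta' i) z * hitw q n m z) (fun z => - f (setsite eta i z)).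
have e x : \sum_(z < n.+1) kq q x z * hitw q n m z * - f (setsite eta i z) =
  - \sum_(z < n.+1) kq q x z * hitw q n m z * f (setsite eta i z).
  by rewrite -sumrN; apply: eq_bigr => z _; rewrite mulrN.
rewrite !e !mulNr lerN2; apply.
  move=> z z' zz; rewrite mulrACA [leRHS]mulrACA [hitw _ _ _ z' * _]mulrC.
  rewrite ler_wpM2r ?mulr_ge0 ?(ltW (hitw_gt0 _ _ _ _)) // kq_tp2 //.
  exact: cle_hgt.
by move=> z z' zz; rewrite lerN2; apply: hf; exact: cle_setsite.
Qed.

Lemma heat_mulr i f F eta : (forall z, F (setsite eta i z) = F eta) ->
  heat i (fun eta => f eta * F eta) eta = heat i f eta * F eta.
Proof.
move=> hF; rewrite /heat mulrAC; congr (_ / _); rewrite mulr_suml.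
by apply: eq_bigr => z _; rewrite hF mulrA.
Qed.

(** The columns are averaged out one at a time from the right. Each average keeps the density
    decreasing, and [F] passes through as a constant. *)
Lemma integrate_right g k : dec g -> (forall eta, 0 <= g eta) -> (k <= n)%N ->
  exists G, [/\ dec G, forall eta, 0 <= G eta &
    forall F, (forall i, (k <= i)%N -> forall eta z, F (setsite eta i z) = F eta) ->
      E (fun eta => g eta * F eta) = pre_exp k (fun eta => G eta * F eta)].
Proof.
move=> hg g0 kn; rewrite -(subKn kn); elim: (n - k)%N (leq_subr k n) => [|m IH] mn.
  by exists g; split => // F _; rewrite subn0 pre_exp_full.
have [G [hG G0 HG]] := IH (ltnW mn).
have im : (n - m.+1 < n)%N by lia.
pose i := Ordinal im; exists (heat i G); split.
- exact: heat_dec.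
- move=> eta; rewrite divr_ge0 ?(ltW (hitw_gt0 _ _ _ _)) // sumr_ge0 // => z _.
  by rewrite !mulr_ge0 ?(ltW (kq_gt0 _ _ _)) ?(ltW (hitw_gt0 _ _ _ _)).
move=> F hF; rewrite HG => [|i' hi']; last by apply: hF; lia.
rewrite (_ : (n - m)%N = i.+1) ?pre_exp_heat /=; last lia.
congr (_ / _); apply: eq_bigr => eta _; rewrite heat_mulr //.
by apply: hF.
Qed.

(** One factor [n + 1] comes from [hitw_le], the other from the number of target heights; the
    exponential bounds up to [n] relative losses of order [1 / (n + 1)]. *)
Definition grad_const : R := (n%:R + 1) ^+ 2 * expR (growth_loss q).

Lemma grad_const_ge0 : 0 <= grad_const.
Proof. by rewrite mulr_ge0 ?sqr_ge0 // expR_ge0. Qed.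

Lemma jump_mass i x L : (x <= n)%N ->
  \sum_(z < n.+1) kq q x z * hitw q n (n - i.+1) z * (x + L <= z)%N%:R <=
  grad_const * q ^+ L * hitw q n (n - i) x.
Proof.
move=> xn; set m := (n - i.+1)%N.
have H0 (y : nat) : 0 < hitw q n m y by exact: hitw_gt0.
have c0 : 0 <= growth_loss q by exact: growth_loss_ge0.
have N0 : 0 < n%:R + 1 :> R by rewrite ltr_wpDl.
set e := expR (growth_loss q); have e0 : 0 <= e by exact: expR_ge0.
have e1 : (1 + growth_loss q / (n%:R + 1)) ^+ m <= e.
  have h : (1 + growth_loss q / (n%:R + 1)) <= expR (growth_loss q / (n%:R + 1)).
    exact: expR_ge1Dx.
  apply: (@le_trans _ _ (expR (growth_loss q / (n%:R + 1)) ^+ m)).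
    by rewrite lerXn2r // nnegrE ?expR_ge0 // addr_ge0 // divr_ge0 // ltW.
  rewrite -expRM_natl ler_expR mulrC -mulrA ler_piMr // ler_pdivrMl // mulr1.
  by rewrite (_ : n%:R + 1 = n.+1%:R) ?natr1 // ler_nat /m; lia.
have hx : hitw q n m x <= hitw q n (n - i) x.
  rewrite hitwS (bigD1 (Ordinal (xn : (x < n.+1)%N))) //= /kq /absdiff subnn expr0 mul1r.
  rewrite lerDl; apply: sumr_ge0 => z _.
  by apply: mulr_ge0; [exact: exprn_ge0 (ltW q0)|exact: ltW].
apply: (@le_trans _ _ (\sum_(z < n.+1) q ^+ L * ((n%:R + 1) * e * hitw q n m x))).
  apply: ler_sum => z _; have zn : (z <= n)%N by rewrite -ltnS.
  have B0 : 0 <= (n%:R + 1) * e * hitw q n m x.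
    apply: mulr_ge0; last exact/ltW/H0.
    by apply: mulr_ge0 => //; exact: ltW.
  case: leqP => xz; last by rewrite mulr0 mulr_ge0 // exprn_ge0 // ltW.
  rewrite mulr1; apply: ler_pM; [exact/ltW/kq_gt0|exact: ltW| |].
    by rewrite /kq; apply: ler_wiXn2l; [exact: ltW|exact: ltW|rewrite /absdiff; lia].
  apply: (le_trans (@hitw_le R q n q0 q1 m x z _)); first by rewrite zn andbT; lia.
  by rewrite ler_wpM2r ?(ltW (H0 _)) // ler_wpM2l // ltW.
rewrite sumr_const card_ord -[leLHS]mulr_natl -natr1 /grad_const -/e.
have -> : (n%:R + 1) ^+ 2 * e * q ^+ L * hitw q n (n - i) x =
  (n%:R + 1) * (q ^+ L * ((n%:R + 1) * e * hitw q n (n - i) x)) by ring.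
rewrite ler_wpM2l ?(ltW N0) // ler_wpM2l ?exprn_ge0 ?(ltW q0) //.
apply: ler_wpM2l => //.
by apply: mulr_ge0 => //; exact: ltW.
Qed.

(* Given the columns up to [i], the decreasing density can only make a jump
   upwards less likely than under [mu]. *)
Lemma heat_jump i L G eta : dec G -> (forall eta, 0 <= G eta) ->
  heat i (fun eta => G eta * (hgt eta i + L <= hgt eta i.+1)%N%:R) eta
  <= grad_const * q ^+ L * heat i G eta.
Proof.
move=> hG G0; set x := hgt eta i; set m := (n - i.+1)%N.
have Hx : 0 < hitw q n (n - i) x by exact: hitw_gt0.
rewrite /heat mulrA ler_pM2r ?invr_gt0 // -/x -/m.
have w0 z : 0 <= kq q x z * hitw q n m z.
  by apply: mulr_ge0; [exact/ltW/kq_gt0|exact/ltW/hitw_gt0].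
have := @mlr_sum R n.+1 (fun z => kq q x z * hitw q n m z * G (setsite eta i z))
  (fun z => kq q x z * hitw q n m z) (fun z => (x + L <= z)%N%:R).
rewrite -hitwS => H; rewrite -(ler_pM2r Hx).
have -> : \sum_(z < n.+1) kq q x z * hitw q n m z * (G (setsite eta i z) *
    (hgt (setsite eta i z) i + L <= hgt (setsite eta i z) i.+1)%N%:R) =
  \sum_(z < n.+1) kq q x z * hitw q n m z * G (setsite eta i z) * (x + L <= z)%N%:R.
  by apply: eq_bigr => z _; rewrite hgt_setsite_l hgt_setsite eqxx mulrA.
apply: le_trans (H _ _) _.
- move=> z z' zz /=; have hz : G (setsite eta i z') <= G (setsite eta i z).
    by apply: hG; exact: cle_setsite.
  rewrite [leLHS]mulrAC [leRHS]mulrAC [_ * (kq _ _ z * _)]mulrC.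
  by apply: ler_wpM2l hz; rewrite mulr_ge0.
- by move=> z z' zz; rewrite ler_nat; case: (leqP (x + L) z) => // h; rewrite (leq_trans h zz).
rewrite mulrAC ler_wpM2r ?jump_mass ?hgt_le //.
by apply: sumr_ge0 => z _; rewrite mulr_ge0.
Qed.

(** Columns to the right of the edge are integrated out, [heat_jump] is applied, and the remaining
    density has total mass one. The last edge leads to the boundary value [0] and cannot jump
    upwards. *)
Lemma grad_up g j L : dec g -> (forall eta, 0 <= g eta) -> E g = 1 -> (0 < L)%N ->
  (j <= n)%N ->
  E (fun eta => g eta * (hgt eta j + L <= hgt eta j.+1)%N%:R) <= grad_const * q ^+ L.
Proof.
move=> hg g0 g1 L0; rewrite leq_eqVlt => /predU1P[->|jn].
  under eq_Emu do rewrite hgt_end leqNgt ltn_addl //= mulr0.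
  by rewrite Emu_cst mulr_ge0 ?grad_const_ge0 // exprn_ge0 // ltW.
pose i := Ordinal jn; have [G [hG G0 HG]] := integrate_right hg g0 (ltn_ord i).
rewrite -[j]/(i : nat) HG => [|i' hi' eta z]; last first.
  by rewrite !hgt_setsite_neq // neq_ltn ?ltnS ?hi' // ltnW.
rewrite pre_exp_heat; apply: le_trans (pre_exp_le _ (fun eta => heat_jump i L eta hG G0)) _.
rewrite pre_expZ -pre_exp_heat.
have := HG (fun=> 1) (fun _ _ _ _ => erefl).
under eq_Emu do rewrite mulr1; rewrite g1 /pre_exp => h.
under [X in _ * (X / _)]eq_bigr => eta do rewrite -[G eta]mulr1.
by rewrite -h mulr1.
Qed.

Definition revc eta : config n := [ffun i => eta (rev_ord i)].

Lemma revcK : involutive revc.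
Proof. by move=> eta; apply/ffunP => i; rewrite !ffunE rev_ordK. Qed.

Lemma hgt_revc eta j : (j <= n.+1)%N -> hgt (revc eta) j = hgt eta (n.+1 - j).
Proof.
case: j => [|j] jn; first by rewrite hgt0 subn0 hgt_end.
move: jn; rewrite ltnS leq_eqVlt => /predU1P[->|jn].
  by rewrite hgt_end subnn hgt0.
have -> : (n.+1 - j.+1)%N = (rev_ord (Ordinal jn)).+1 by rewrite /=; lia.
by rewrite hgt_site -[j]/(Ordinal jn : nat) hgt_site ffunE.
Qed.

Lemma weight_revc eta : weight beta (revc eta) = weight beta eta.
Proof.
rewrite !weight_edges (reindex_inj rev_ord_inj) /=; apply: eq_bigr => j _.
have jn := ltn_ord j; rewrite !hgt_revc /=; [|lia|lia].
rewrite kqC; congr (kq _ (hgt eta _) (hgt eta _)); lia.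
Qed.

Lemma Emu_revc f : E (fun eta => f (revc eta)) = E f.
Proof.
rewrite /Emu [RHS](reindex_inj (inv_inj revcK)); apply: eq_bigr => eta _.
by rewrite /mu weight_revc.
Qed.

(** Reversing the positions preserves [mu] and the order on configurations, and turns a fall across
    edge [j] into a rise across edge [n - j]. *)
Lemma grad_down g j L : dec g -> (forall eta, 0 <= g eta) -> E g = 1 -> (0 < L)%N ->
  (j <= n)%N ->
  E (fun eta => g eta * (hgt eta j.+1 + L <= hgt eta j)%N%:R) <= grad_const * q ^+ L.
Proof.
move=> hg g0 g1 L0 jn; rewrite -Emu_revc.
have hr : dec (fun eta => g (revc eta)).
  by move=> eta eta' h; apply: hg => i; rewrite !ffunE.
have := @grad_up (fun eta => g (revc eta)) (n - j) L hr (fun _ => g0 _) _ L0 (leq_subr _ _).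
rewrite Emu_revc => /(_ g1); apply: le_trans; rewrite le_eqVlt; apply/orP; left.
apply/eqP/eq_Emu => eta; rewrite !hgt_revc //; last exact: leqW.
by rewrite subSS -subSn.
Qed.

End Gradient.

(** * Recursion for the deficits of the mean heights *)

Section Recursion.
Variables (R : realType) (beta : R) (n : nat).
Hypotheses (hbeta : 0 < beta) (n0 : (0 < n)%N).
Implicit Types (eta : config n) (i : 'I_n) (A : pred 'I_n) (s : seq (pred 'I_n)).
Local Notation E := (Emu beta).
Local Notation q := (expR (- beta)).
Let q0 : 0 < q := q_gt0 beta.
Let q1 : q < 1 := q_lt1 hbeta.
Local Notation tau := (n%:R^-1 : R).

Let tau0 : 0 <= tau. Proof. by rewrite invr_ge0. Qed.
Let tau1 : tau <= 1. Proof. by rewrite invf_le1 ?ltr0n // ler1n. Qed.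

Lemma site_op_indep i (f : config n -> R) eta : (forall z, f (setsite eta i z) = f eta) ->
  site_op beta i f eta = f eta.
Proof. by move=> h; rewrite /site_op /Defs.down /Defs.up !h; ring. Qed.

Lemma iter_cens_op_indep A T (f : config n -> R) :
  (forall i eta z, A i -> f (setsite eta i z) = f eta) ->
  iter T (cens_op beta A) f =1 f.
Proof.
move=> hf eta; suff -> : iter T (cens_op beta A) f = f by [].
elim: T => [//|T IH] /=; rewrite IH; apply: boolp.funext => e.
rewrite /cens_op (eq_bigr (fun=> f e)) => [|i _].
  by rewrite sumr_const card_ord -[f e *+ n]mulr_natl mulKf // pnatr_eq0 -lt0n.
by case: ifP => // Ai; rewrite site_op_indep // => z; exact: hf.
Qed.

(** No neighbour of [i] belongs to [A], so the neighbours stay frozen, and picking any other site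
    leaves the observable unchanged; what remains is the column chain slowed down by [1 / n]. *)
Lemma iter_cens_op_col A i T : A i ->
  (forall k : 'I_n, A k -> (k.+1 != i)%N && (k != i.+1 :> nat)) ->
  forall eta, iter T (cens_op beta A) (fun eta => (hgt eta i.+1)%:R) eta =
    col_iter q n tau (hgt eta i) (hgt eta i.+2) T (hgt eta i.+1).
Proof.
move=> Ai hA eta; pose F eta := col_iter q n tau (hgt eta i) (hgt eta i.+2) T (hgt eta i.+1).
rewrite -/(F eta); suff -> : iter T (cens_op beta A) (fun eta => (hgt eta i.+1)%:R) = F by [].
rewrite {}/F; elim: T {eta} => [//|T IH]; apply: boolp.funext => eta /=; rewrite IH.
set F := (fun eta => _); rewrite /cens_op (bigD1 i) //= Ai.
rewrite (eq_bigr (fun=> F eta)) => [|k ki]; last first.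
  case: ifP => // Ak; rewrite site_op_indep // => z; rewrite /F.
  have /andP[h1 h2] := hA k Ak; rewrite !hgt_setsite_neq // 1?eqSS eq_sym //.
rewrite sumr_const (_ : #|_| = n.-1)%N; last first.
  by have := cardC1 i; rewrite card_ord => <-; apply: eq_card => k; rewrite !inE.
rewrite site_opE /lcol -hgt_site.
have -> : colfun F eta i = fun y => F (setsite eta i (inord y)) by [].
have -> : kcol q n (hgt eta i) (hgt eta i.+2) (fun y => F (setsite eta i (inord y)))
    (hgt eta i.+1) =
  kcol q n (hgt eta i) (hgt eta i.+2)
    (iter T (lcol q n tau (hgt eta i) (hgt eta i.+2)) (fun z => z%:R)) (hgt eta i.+1).
  have hn := hgt_le eta i.+1; rewrite /kcol /F.
  by rewrite !hgt_setsite_l !hgt_setsite_r !hgt_setsite eqxx !inordK //; lia.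
rewrite -[F eta *+ _]mulr_natl -subn1 natrB // mulrDr mulrA mulrBr mulVf ?pnatr_eq0 -?lt0n //.
by rewrite mulr1 addrC.
Qed.

Lemma Emu_colmean i :
  E (fun eta => colmean q n (hgt eta i) (hgt eta i.+2)) = E (fun eta => (hgt eta i.+1)%:R).
Proof.
rewrite !(Emu_col _ _ i); congr (_ * _); apply: eq_bigr => eta _; congr (_ * _).
transitivity (\sum_(z < n.+1) wcol q (hgt eta i) (hgt eta i.+2) z *
    colmean q n (hgt eta i) (hgt eta i.+2)).
  by apply: eq_bigr => z _; rewrite colfun_ord hgt_setsite_l hgt_setsite_r.
rewrite -mulr_suml /colmean mulrC divfK ?gt_eqF ?wcol_mass_gt0 //.
by apply: eq_bigr => z _; rewrite colfun_ord hgt_setsite eqxx.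
Qed.

(** If both edges at the site are less than [L] steep, the neighbours are within [2 L] of each other
    and the column relaxes. Otherwise the error is at most [n], on one of four events: two edges,
    two directions. *)
Definition block_err (T L : nat) : R :=
  (1 - tau * gapW q (2 * L)) ^+ T * ((n%:R + 1) * n%:R * relax_const q (2 * L) L)
  + n%:R * (4 * (grad_const beta n * q ^+ L)).

Lemma relax_const_ge0 W L : 0 <= relax_const q W L.
Proof.
apply: mulr_ge0; last by rewrite exprn_ge0 // invr_ge0 ltW.
have p0 : 0 < 1 - q by rewrite subr_gt0.
by rewrite addr_ge0 ?sqr_ge0 // divr_ge0 ?(ltW p0) // addr_ge0.
Qed.

Let relax_ge0 T L :
  0 <= (1 - tau * gapW q (2 * L)) ^+ T * ((n%:R + 1) * n%:R * relax_const q (2 * L) L).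
Proof.
apply: mulr_ge0; first by rewrite exprn_ge0 // contr_ge0.
by apply: mulr_ge0; [rewrite mulr_ge0 ?addr_ge0|exact: relax_const_ge0].
Qed.

Lemma block_err_ge0 T L : 0 <= block_err T L.
Proof.
by rewrite addr_ge0 // !mulr_ge0 ?grad_const_ge0 // exprn_ge0 // ltW.
Qed.

Lemma col_gap_le i T L eta :
  colmean q n (hgt eta i) (hgt eta i.+2)
    - col_iter q n tau (hgt eta i) (hgt eta i.+2) T (hgt eta i.+1) <=
  (1 - tau * gapW q (2 * L)) ^+ T * ((n%:R + 1) * n%:R * relax_const q (2 * L) L)
  + n%:R * ((hgt eta i + L <= hgt eta i.+1)%N%:R + (hgt eta i.+1 + L <= hgt eta i)%N%:R
     + ((hgt eta i.+1 + L <= hgt eta i.+2)%N%:R + (hgt eta i.+2 + L <= hgt eta i.+1)%N%:R)).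
Proof.
set l := hgt eta i; set y := hgt eta i.+1; set r := hgt eta i.+2.
have ln : (l <= n)%N by exact: hgt_le.
have rn : (r <= n)%N by exact: hgt_le.
have yn : (y <= n)%N by exact: hgt_le.
set b := (X in n%:R * X).
have b0 : 0 <= b by rewrite !addr_ge0.
have [good|bad] := boolP [&& (l < y + L)%N, (y < l + L)%N, (y < r + L)%N & (r < y + L)%N].
  apply: (@le_trans _ _ ((1 - tau * gapW q (2 * L)) ^+ T *
      ((n%:R + 1) * n%:R * relax_const q (2 * L) L))); last by rewrite lerDl mulr_ge0.
  by apply: col_relax => //; move: good; lia.
have b1 : 1 <= b.
  rewrite /b -!natrD ler1n; move: bad; rewrite !negb_and -!leqNgt.
  by case/or4P => ->; lia.
have u0 : 0 <= col_iter q n tau l r T y.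
  elim: T y yn {b b0 bad b1} => [//|T IH] y yn /=; rewrite /lcol.
  apply: addr_ge0; first by rewrite mulr_ge0 ?subr_ge0 // IH.
  rewrite mulr_ge0 //; have -> : 0 = kcol q n l r (fun=> 0) y :> R by rewrite /kcol; ring.
  by apply: kcol_le => // z zn; exact: IH.
have f1 : colmean q n l r <= n%:R.
  rewrite ler_pdivrMr ?wcol_mass_gt0 // mulr_sumr; apply: ler_sum => z _.
  by rewrite mulrC ler_wpM2r ?(ltW (wcol_gt0 _ _ _ _)) // ler_nat -ltnS.
apply: (@le_trans _ _ n%:R); first by lra.
by rewrite -[leLHS]add0r lerD // ler_peMr.
Qed.

Definition hgap s (j : nat) : R :=
  E (fun eta => (hgt eta j)%:R) - E (fun eta => cens_dens beta s eta * (hgt eta j)%:R).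

Lemma hgap_bot s : hgap s 0 = 0.
Proof.
rewrite /hgap; under [X in _ - X]eq_Emu do rewrite hgt0 mulr0.
by rewrite !Emu_cst subrr.
Qed.

Lemma hgap_top s : hgap s n.+1 = 0.
Proof.
rewrite /hgap; under [X in _ - X]eq_Emu do rewrite hgt_end mulr0.
by under [X in X - _]eq_Emu do rewrite hgt_end; rewrite !Emu_cst subrr.
Qed.

Lemma cens_dens_block A T s (f : config n -> R) :
  E (fun eta => cens_dens beta (nseq T A ++ s) eta * f eta) =
  E (fun eta => cens_dens beta s eta * iter T (cens_op beta A) f eta).
Proof.
elim: T f => [//|T IH] f; rewrite iterSr -IH /= cens_op_selfadj //.
Qed.

Lemma hgap_indep A T s i : ~~ A i -> hgap (nseq T A ++ s) i.+1 = hgap s i.+1.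
Proof.
move=> Ai; rewrite /hgap cens_dens_block; congr (_ - _); apply: eq_Emu => eta.
congr (_ * _); apply: iter_cens_op_indep => k e z Ak; rewrite hgt_setsite_neq //.
by rewrite eqSS; apply: contraNneq Ai => e'; rewrite (_ : i = k) //; exact: val_inj.
Qed.

(* The walls push the column mean off the midpoint of the neighbours by an amount
   that decreases with the neighbours, hence helps the comparison with [mu]. *)
Lemma hgap_step A T L s i : A i -> (0 < L)%N ->
  (forall k : 'I_n, A k -> (k.+1 != i)%N && (k != i.+1 :> nat)) ->
  hgap (nseq T A ++ s) i.+1 <= (hgap s i + hgap s i.+2) / 2 + block_err T L.
Proof.
move=> Ai L0 hA; rewrite {1}/hgap cens_dens_block -Emu_colmean.
under [X in _ - X <= _]eq_Emu do rewrite iter_cens_op_col //.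
set g := cens_dens beta s.
pose f eta := colmean q n (hgt eta i) (hgt eta i.+2).
pose u eta := col_iter q n tau (hgt eta i) (hgt eta i.+2) T (hgt eta i.+1).
pose c eta := f eta - ((hgt eta i)%:R + (hgt eta i.+2)%:R) / 2.
rewrite -/(E f) -[X in _ - X <= _]/(E (fun eta => g eta * u eta)).
have g0 eta : 0 <= g eta by exact: cens_dens_ge0.
have g1 : E g = 1 by exact: Emu_cens_dens.
have gd : dec g by exact: cens_dens_dec.
have hc : E c <= E (fun eta => g eta * c eta).
  have ic : inc (fun eta => - c eta).
    move=> eta eta' h; rewrite lerN2; apply: colmean_corr_le => //.
      by rewrite cle_hgt // hgt_le.
    by rewrite cle_hgt // hgt_le.
  have := cens_dens_le_mu hbeta n0 s ic.
  have -> : E (fun eta => - c eta) = - E c.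
    by rewrite -mulN1r -EmuZ; apply: eq_Emu => eta; rewrite mulN1r.
  have -> : E (fun eta => cens_dens beta s eta * - c eta) = - E (fun eta => g eta * c eta).
    by rewrite -mulN1r -EmuZ; apply: eq_Emu => eta; rewrite mulN1r mulrN.
  by rewrite lerN2.
have e1 : E c = E f - (E (fun eta => (hgt eta i)%:R) + E (fun eta => (hgt eta i.+2)%:R)) / 2.
  rewrite EmuB -EmuD; congr (_ - _); rewrite mulrC -EmuZ; apply: eq_Emu => eta.
  by rewrite mulrC.
have e2 : E (fun eta => g eta * c eta) = E (fun eta => g eta * f eta) -
    (E (fun eta => g eta * (hgt eta i)%:R) + E (fun eta => g eta * (hgt eta i.+2)%:R)) / 2.
  rewrite -EmuD [X in _ - X]mulrC -EmuZ -EmuB; apply: eq_Emu => eta.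
  by rewrite /c; ring.
have err : E (fun eta => g eta * (f eta - u eta)) <= block_err T L.
  set K := (1 - tau * gapW q (2 * L)) ^+ T * ((n%:R + 1) * n%:R * relax_const q (2 * L) L).
  apply: (@le_trans _ _ (E (fun eta => K * g eta + n%:R *
    ((g eta * (hgt eta i + L <= hgt eta i.+1)%N%:R
      + g eta * (hgt eta i.+1 + L <= hgt eta i)%N%:R)
     + (g eta * (hgt eta i.+1 + L <= hgt eta i.+2)%N%:R
      + g eta * (hgt eta i.+2 + L <= hgt eta i.+1)%N%:R))))).
    apply: Emu_le => eta; apply: le_trans (ler_wpM2l (g0 eta) (col_gap_le i T L eta)) _.
    by rewrite -/K le_eqVlt; apply/orP; left; apply/eqP; ring.
  rewrite EmuD EmuZ EmuZ !EmuD g1 mulr1 lerD2l ler_wpM2l //.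
  have iP : (i <= n)%N by exact: ltnW.
  have h1 := grad_up hbeta gd g0 g1 L0 iP; have h2 := grad_down hbeta gd g0 g1 L0 iP.
  have h3 := grad_up hbeta gd g0 g1 L0 (ltn_ord i).
  have h4 := grad_down hbeta gd g0 g1 L0 (ltn_ord i).
  by move: h1 h2 h3 h4; lra.
have e3 : E (fun eta => g eta * (f eta - u eta)) =
    E (fun eta => g eta * f eta) - E (fun eta => g eta * u eta).
  by rewrite -EmuB; apply: eq_Emu => eta; ring.
by move: hc err; rewrite e1 e2 e3 /hgap -/g; lra.
Qed.

(** Averaging the two neighbouring values of this parabola lowers it by exactly [1]. *)
Definition parab (j : nat) : R := j%:R * (n%:R + 1 - j%:R).

Lemma parab_ge0 j : (j <= n.+1)%N -> 0 <= parab j.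
Proof. by move=> jn; rewrite mulr_ge0 // natr1 subr_ge0 ler_nat. Qed.

Lemma parab_le j : parab j <= (n%:R + 1) ^+ 2 / 4.
Proof.
have := sqr_ge0 (j%:R - (n%:R + 1 - j%:R) : R); rewrite /parab.
by move: (n%:R : R) (j%:R : R) => x y; lra.
Qed.

Definition parity (b : bool) : pred 'I_n := fun i => odd i == b.

Lemma parity_sep b i : parity b i ->
  forall k : 'I_n, parity b k -> (k.+1 != i)%N && (k != i.+1 :> nat).
Proof.
rewrite /parity => /eqP hi k /eqP hk; apply/andP; split; apply/eqP => e.
  by move: hi; rewrite -e /= hk; case: (b).
by move: hk; rewrite e /= hi; case: (b).
Qed.

Lemma hgap_block b T L s (H e : R) : (0 < L)%N -> 0 <= e ->
  (forall j, (j <= n.+1)%N -> hgap s j <= H * parab j + e) ->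
  forall i, hgap (nseq T (parity b) ++ s) i.+1 <=
    if parity b i then H * (parab i.+1 - 1) + e + block_err T L else H * parab i.+1 + e.
Proof.
move=> L0 e0 h i; have iP := ltn_ord i; case: ifP => [pi|/negbT pi].
  apply: le_trans (hgap_step T s pi L0 (parity_sep pi)) _; rewrite lerD2r.
  have h1 := h i (leqW (ltnW iP)); have h2 := h i.+2 iP.
  have : H * parab i + H * parab i.+2 = 2 * (H * (parab i.+1 - 1)).
    by rewrite /parab -(natr1 i.+1) -(natr1 i); ring.
  by move: h1 h2; lra.
by rewrite hgap_indep //; apply: h; exact: leqW.
Qed.

Definition rounds (T m : nat) : seq (pred 'I_n) :=
  iter m (fun s => nseq T (parity true) ++ nseq T (parity false) ++ s) [::].

Lemma size_rounds T m : size (rounds T m) = (2 * m * T)%N.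
Proof.
elim: m => [//|m IH]; rewrite /rounds /= -/(rounds T m) !size_cat !size_nseq IH.
by lia.
Qed.

(** As [parab] is at most [(n + 1) ^ 2 / 4], subtracting [1] from it is at least a contraction by
    this factor. *)
Definition contr : R := 1 - 4 / (n%:R + 1) ^+ 2.

Lemma contr_ge : 0 <= contr.
Proof.
rewrite subr_ge0 ler_pdivrMr ?mul1r; last by rewrite exprn_gt0 // ltr_wpDl.
have : 1 <= n%:R :> R by rewrite ler1n.
by move: (n%:R : R) => x hx; nra.
Qed.

(** Initially a deficit is at most [n], hence at most [parab] at every interior position. In each
    round every interior column is lowered once, while a block leaves the bounds of the other parity
    in place; the two blocks add one error each. *)
Lemma hgap_rounds T L m : (0 < L)%N -> forall j, (j <= n.+1)%N ->
  hgap (rounds T m) j <= contr ^+ m * parab j + 2 * m%:R * block_err T L.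
Proof.
move=> L0; have d0 := block_err_ge0 T L; elim: m => [|m IH] j jn.
  rewrite expr0 mul1r mulr0 mul0r addr0; case: j jn => [|j].
    by rewrite hgap_bot parab_ge0.
  rewrite ltnS leq_eqVlt => /predU1P[->|jn]; first by rewrite hgap_top parab_ge0.
  apply: (@le_trans _ _ n%:R).
    rewrite /hgap lerBlDr; apply: (@le_trans _ _ n%:R).
      rewrite -[leRHS](Emu_cst beta n); apply: Emu_le => eta.
      by rewrite ler_nat hgt_le.
    rewrite lerDl -[leLHS](Emu_cst beta n); apply: Emu_le => eta.
    by rewrite mulr_ge0 // cens_dens_ge0.
  rewrite /parab -natr1.
  have : j%:R + 1 <= n%:R :> R by rewrite natr1 ler_nat.
  have : 0 <= j%:R :> R by [].
  by move: (n%:R : R) (j%:R : R) => x y; nra.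
set H := contr ^+ m in IH; set e := 2 * m%:R * _ in IH.
have H0 : 0 <= H by rewrite exprn_ge0 // contr_ge.
have e0 : 0 <= e by rewrite /e mulr_ge0 // mulr_ge0.
set s1 := nseq T (parity false) ++ rounds T m.
have h1 := hgap_block false T L0 e0 IH.
have sN (k : nat) : H * (parab k.+1 - 1) <= H * parab k.+1 by rewrite ler_wpM2l // gerBl.
have h1' k : (k <= n.+1)%N -> hgap s1 k <= H * parab k + (e + block_err T L).
  have de : 0 <= e + block_err T L by rewrite addr_ge0.
  case: k => [_|k]; first by rewrite hgap_bot addr_ge0 // mulr_ge0 // parab_ge0.
  rewrite ltnS leq_eqVlt => /predU1P[->|kn].
    by rewrite hgap_top addr_ge0 // mulr_ge0 // parab_ge0.
  have := h1 (Ordinal kn); have := sN k; rewrite /=.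
  by case: ifP => _; move: d0; rewrite /s1; lra.
have h2 := hgap_block true T L0 (addr_ge0 e0 d0) h1'.
have ee : 2 * m.+1%:R * block_err T L = e + block_err T L + block_err T L.
  by rewrite /e -natr1; ring.
have step (k : nat) : H * (parab k.+1 - 1) <= contr ^+ m.+1 * parab k.+1.
  rewrite exprSr -/H -mulrA ler_wpM2l // /contr mulrBl mul1r lerD2l lerN2.
  rewrite mulrAC ler_pdivrMr ?exprn_gt0 ?ltr_wpDl // mul1r.
  by have := parab_le k.+1; lra.
have base k : (k <= n.+1)%N ->
    0 <= contr ^+ m.+1 * parab k + (e + block_err T L + block_err T L).
  move=> kn; have := parab_ge0 kn; have c0 : 0 <= contr ^+ m.+1.
    by rewrite exprn_ge0 // contr_ge.
  by move=> /(mulr_ge0 c0); lra.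
rewrite ee; case: j jn => [_|j]; first by rewrite hgap_bot base.
rewrite ltnS leq_eqVlt => /predU1P[->|jn]; first by rewrite hgap_top base.
pose i := Ordinal jn; rewrite -[j]/(i : nat).
have := h2 i; have := h1 i; have := step i.
have [odd_i|even_i] := boolP (odd i).
  have -> : parity true i by rewrite /parity odd_i.
  have -> : parity false i = false by rewrite /parity odd_i.
  by move=> A1 _ A2; apply: (le_trans A2); lra.
have pt : parity true i = false by rewrite /parity (negbTE even_i).
have -> : parity false i by rewrite /parity (negbTE even_i).
rewrite pt => A1 A2 _; rewrite [rounds T m.+1]/= -/s1 hgap_indep ?pt //.
by apply: (le_trans A2); lra.
Qed.

Lemma tv_rounds T L m : (0 < L)%N ->
  tv_to_mu beta n (2 * m * T) <=
  n%:R * (contr ^+ m * (n%:R + 1) ^+ 2 + 2 * m%:R * block_err T L).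
Proof.
move=> L0; rewrite -size_rounds; apply: le_trans (tv_le_heights hbeta n0 _) _.
set X := _ + _; have -> : n%:R * X = \sum_(i < n) X by rewrite sumr_const card_ord mulr_natl.
apply: ler_sum => i _.
rewrite -/(hgap _ _); apply: le_trans (hgap_rounds T m L0 _) _.
  exact: leqW.
rewrite lerD2r ler_wpM2l ?exprn_ge0 ?contr_ge //.
by have := parab_le i.+1; have := sqr_ge0 (n%:R + 1 : R); lra.
Qed.

End Recursion.

(** * Elementary estimates on powers *)

Section Asymptotics.
Variables (R : realType).

(** Combine [(1 - x) ^ k (1 + x) ^ k <= 1] with Bernoulli's inequality
    [(1 + x) ^ k >= 1 + k x >= 2]. *)
Lemma half_pow (x : R) k : 0 <= x -> x <= 1 -> 1 <= k%:R * x -> (1 - x) ^+ k <= 2^-1.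
Proof.
move=> x0 x1 kx.
have bern : 1 + k%:R * x <= (1 + x) ^+ k.
  elim: k {kx} => [|k IH]; first by rewrite mul0r addr0.
  have kx0 : 0 <= k%:R * x by rewrite mulr_ge0.
  rewrite exprS -natr1; apply: (@le_trans _ _ ((1 + x) * (1 + k%:R * x))).
    by have := mulr_ge0 x0 kx0; lra.
  by rewrite ler_wpM2l // addr_ge0.
have p1 : (1 - x) ^+ k * (1 + x) ^+ k <= 1.
  rewrite -exprMn exprn_ile1 //; first by rewrite mulr_ge0 ?subr_ge0 ?addr_ge0.
  by have := sqr_ge0 x; lra.
rewrite -[leRHS]mul1r ler_pdivlMr //; apply: le_trans p1.
by rewrite ler_wpM2l ?exprn_ge0 ?subr_ge0 //; lra.
Qed.

Lemma half_pow_mul (x : R) k p : 0 <= x -> x <= 1 -> 1 <= k%:R * x ->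
  (1 - x) ^+ (k * p) <= (2 ^+ p)^-1.
Proof.
move=> x0 x1 kx; rewrite exprM -exprVn.
by rewrite lerXn2r ?nnegrE ?exprn_ge0 ?subr_ge0 ?invr_ge0 // half_pow.
Qed.

Lemma exists_pow_le (q : R) : 0 < q -> q < 1 -> exists2 c, (0 < c)%N & q ^+ c <= (2 ^+ 8)^-1.
Proof.
move=> q0 q1; have p0 : 0 < 1 - q by rewrite subr_gt0.
have i0 : 0 <= (1 - q)^-1 by rewrite invr_ge0 ltW.
have := archi_boundP i0.
set k := Num.bound _ => hk; exists (k.+1 * 8)%N; first by rewrite muln_gt0.
have -> : q = 1 - (1 - q) by rewrite opprB addrC subrK.
apply: half_pow_mul; [exact: ltW|by rewrite gerBl ltW|].
rewrite -ler_pdivrMr // mul1r (le_trans (ltW hk)) // ler_nat; lia.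
Qed.

Lemma exists_pow2_ge (x : R) : 0 <= x -> exists b, x <= 2 ^+ b.
Proof.
move=> x0; exists (Num.bound x); apply: le_trans (ltW (archi_boundP x0)) _.
by rewrite -natrX ler_nat ltnW // ltn_expl.
Qed.

End Asymptotics.

Lemma double_succ_le c l : (0 < c * l)%N -> ((2 * (c * l)).+1 <= 3 * c * l)%N.
Proof. lia. Qed.

(** * Choice of the parameters and the final bound *)

Section MixingTime.
Variables (R : realType) (beta : R).
Hypothesis hbeta : 0 < beta.
Local Notation q := (expR (- beta)).
Let q0 : 0 < q := q_gt0 beta.
Let q1 : q < 1 := q_lt1 hbeta.

(* [c], [b] and [K] calibrate the gradient cut-off [L = c l], the price
   [q^-L <= (2 ^ l) ^ b] of the envelope at distance [L], and the relaxation time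
   [n K l ^ 2] of a column. *)
Variables (c b K : nat).
Hypotheses (c0 : (0 < c)%N) (hc : q ^+ c <= (2 ^+ 8)^-1) (hb : q^-1 ^+ c <= 2 ^+ b).
Hypothesis hK : 36 * c%:R ^+ 2 <= K%:R * (1 - q) ^+ 2.

(** The successor ensures [2 ^ l >= n + 1], so that every quantity below is measured in powers of
    [P = 2 ^ l]. *)
Definition log2 (n : nat) : nat := (trunc_log 2 n).+1.

Definition cut_const : R :=
  3 * c%:R / (1 - q) + 4 * c%:R ^+ 2 + 4 * expR (growth_loss q).

Lemma cut_const_ge0 : 0 <= cut_const.
Proof.
have p0 : 0 < 1 - q by rewrite subr_gt0.
by rewrite !addr_ge0 // ?mulr_ge0 ?expR_ge0 ?sqr_ge0 // invr_ge0 ltW.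
Qed.

Section FixedSize.
Variable n : nat.
Hypothesis n2 : (2 <= n)%N.
Let n0n : (0 < n)%N := ltnW n2.
Local Notation l := (log2 n).
Local Notation P := (2 ^+ l : R).

Lemma nP : n%:R + 1 <= P.
Proof. by rewrite natr1 -natrX ler_nat trunc_log_ltn. Qed.

Lemma lP : l%:R <= P.
Proof. by rewrite -natrX ler_nat ltnW // ltn_expl. Qed.

Lemma P1 : 1 <= P.
Proof. by rewrite exprn_ege1 // ler1n. Qed.

Lemma l1 : 1 <= l%:R :> R.
Proof. by rewrite ler1n. Qed.

(** Up to constants, relaxation contributes [P^-(9 + b) * P^2 * P^(2 + b)] and steep edges
    contribute [P * P^2 * P^-8]: both are [P^-5]. This leaves a factor [1 / P] after at most [P]
    sites and a number of rounds of order [P^3]. *)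
Lemma block_err_bound :
  block_err beta n (n * K * l ^ 2 * (l * (9 + b))) (c * l) <= cut_const / P ^+ 5.
Proof.
have p0 : 0 < 1 - q by rewrite subr_gt0.
have n0 : 0 < n%:R :> R by rewrite ltr0n.
have P0 : 0 < P by rewrite exprn_gt0.
have := nP; have := lP; have := P1; have := l1 => hl hP hlP hnP.
have c1 : 1 <= c%:R :> R by rewrite ler1n.
have PN (k : nat) : P ^+ k = (2 ^+ (k * l))%:R :> R by rewrite -exprM mulnC natrX.
have hqL : q ^+ (c * l) <= (P ^+ 8)^-1.
  have -> : (P ^+ 8)^-1 = (2 ^+ 8)^-1 ^+ l by rewrite exprVn -!exprM mulnC.
  rewrite exprM.
  by rewrite lerXn2r ?nnegrE ?exprn_ge0 ?invr_ge0 ?exprn_ge0 // ltW.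
have hrL : q^-1 ^+ (c * l) <= P ^+ b.
  have -> : P ^+ b = (2 ^+ b) ^+ l by rewrite -!exprM mulnC.
  rewrite exprM.
  by rewrite lerXn2r ?nnegrE ?exprn_ge0 ?invr_ge0 // ltW.
have hL : (2 * (c * l))%:R + 1 <= 3 * c%:R * l%:R :> R.
  by rewrite natr1 -!natrM ler_nat double_succ_le // muln_gt0 c0.
set L := (c * l)%N in hqL hrL hL *.
have g0 := gapW_ge0 q (2 * L); have g1 := gapW_le1 q0 q1 (2 * L).
have ti : 0 <= n%:R^-1 :> R by rewrite invr_ge0.
have ti1 : n%:R^-1 <= 1 :> R by rewrite invf_le1 // ler1n.
(* From [2 L + 1 <= 3 c l] one gets [gapW >= (1 - q)^2 / (36 c^2 l^2)], the origin of the [36] in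
   [hK]. Hence [n K l^2] steps halve the error, and [l (9 + b)] halvings give the power of [P]. *)
have relaxT : (1 - n%:R^-1 * gapW q (2 * L)) ^+ (n * K * l ^ 2 * (l * (9 + b)))
    <= (P ^+ (9 + b))^-1.
  rewrite -exprM; apply: half_pow_mul; first by rewrite mulr_ge0.
    by rewrite mulr_ile1.
  have -> : (n * K * l ^ 2)%:R * (n%:R^-1 * gapW q (2 * L)) =
      K%:R * l%:R ^+ 2 * gapW q (2 * L).
    by rewrite !natrM; field; rewrite gt_eqF.
  have D0 : 0 < 4 * ((2 * L)%:R + 1) ^+ 2 :> R.
    by rewrite mulr_gt0 // exprn_gt0 // ltr_wpDl.
  rewrite /gapW mulrA ler_pdivlMr // mul1r.
  apply: (@le_trans _ _ (4 * (3 * c%:R * l%:R) ^+ 2)).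
    by rewrite ler_wpM2l // lerXn2r // nnegrE ?addr_ge0 // !mulr_ge0.
  have -> : 4 * (3 * c%:R * l%:R) ^+ 2 = 36 * c%:R ^+ 2 * l%:R ^+ 2 :> R by ring.
  by rewrite [leRHS]mulrAC ler_wpM2r ?sqr_ge0.
have i0 : 0 <= (1 - q)^-1 by rewrite invr_ge0 ltW.
set C2 := 3 * c%:R / (1 - q) + 4 * c%:R ^+ 2 : R.
have C20 : 0 <= C2 by rewrite addr_ge0 ?mulr_ge0 ?sqr_ge0.
have relax_le : relax_const q (2 * L) L <= C2 * P ^+ 2 * P ^+ b.
  apply: ler_pM => //.
    by rewrite addr_ge0 ?sqr_ge0 // mulr_ge0 // addr_ge0.
  rewrite /C2 [leRHS]mulrDl; apply: lerD.
    rewrite mulrAC ler_wpM2r //; apply: (le_trans hL); rewrite ler_wpM2l ?mulr_ge0 //.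
    by rewrite (le_trans hlP) // expr2 ler_peMl // ltW.
  have -> : (2 * L)%:R ^+ 2 = 4 * c%:R ^+ 2 * l%:R ^+ 2 :> R by rewrite /L !natrM; ring.
  by rewrite ler_wpM2l ?mulr_ge0 ?sqr_ge0 // lerXn2r // nnegrE // ltW.
have nn : (n%:R + 1) * n%:R <= P ^+ 2.
  rewrite expr2 ler_pM ?addr_ge0 // (le_trans _ hnP) // lerDl //.
rewrite /block_err /cut_const -/C2 [leRHS]mulrDl; apply: lerD.
  apply: (@le_trans _ _ ((P ^+ (9 + b))^-1 * (P ^+ 2 * (C2 * P ^+ 2 * P ^+ b)))).
    apply: ler_pM => //.
    - by rewrite exprn_ge0 // subr_ge0 mulr_ile1.
    - by apply: mulr_ge0; [rewrite mulr_ge0 ?addr_ge0|exact: relax_const_ge0].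
    by apply: ler_pM => //; exact: relax_const_ge0.
  rewrite le_eqVlt; apply/orP; left; apply/eqP; rewrite exprD.
  move: P P0 => p p0'; have pb : p ^+ b != 0 by rewrite expf_neq0 // gt_eqF.
  by field; rewrite pb gt_eqF.
apply: (@le_trans _ _ (P * (4 * (P ^+ 2 * expR (growth_loss q) * (P ^+ 8)^-1)))).
  have e0 := expR_ge0 (growth_loss q).
  have P80 : 0 <= (P ^+ 8)^-1 by rewrite invr_ge0 exprn_ge0 // ltW.
  apply: ler_pM => //.
  - by rewrite !mulr_ge0 ?sqr_ge0 // exprn_ge0 // ltW.
  - by apply: le_trans hnP; rewrite lerDl.
  rewrite ler_wpM2l //; apply: ler_pM => //.
    by rewrite mulr_ge0 ?sqr_ge0.
  by rewrite ler_wpM2r // lerXn2r // nnegrE ?addr_ge0 // ltW.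
rewrite le_eqVlt; apply/orP; left; apply/eqP.
by move: P P0 => p p0'; field; rewrite gt_eqF.
Qed.

(** Two blocks per round; [4 l] halvings of the deficits at [n ^ 2] rounds each; and [l (9 + b)]
    halvings of the column error at [n K l ^ 2] steps each. *)
Definition mix_time : nat := (2 * (n ^ 2 * (4 * l)) * (n * K * l ^ 2 * (l * (9 + b))))%N.

Lemma tv_mix_time : tv_to_mu beta n mix_time <= (1 + 8 * cut_const) / (n%:R + 1).
Proof.
have P0 : 0 < P by rewrite exprn_gt0.
have := nP; have := lP; have := P1 => hP hlP hnP.
have L0 : (0 < c * l)%N by rewrite muln_gt0 c0.
have n1 : 1 <= n%:R :> R by rewrite ler1n.
have N0 : 0 < n%:R + 1 :> R by rewrite ltr_wpDl.
have nle : n%:R <= P by apply: le_trans hnP; rewrite lerDl.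
apply: (le_trans (tv_rounds hbeta n0n _ _ L0)).
have hcontr : contr R n ^+ (n ^ 2 * (4 * l)) <= (P ^+ 4)^-1.
  have -> : (P ^+ 4)^-1 = (2 ^+ (4 * l))^-1 :> R by rewrite -exprM mulnC.
  have S0 : 0 < (n%:R + 1) ^+ 2 :> R by rewrite exprn_gt0.
  apply: half_pow_mul; first by rewrite divr_ge0 // ltW.
    rewrite ler_pdivrMr // mul1r; have : (1 + 1) ^+ 2 <= (n%:R + 1) ^+ 2 :> R.
      by rewrite lerXn2r ?nnegrE ?addr_ge0 // lerD2r.
    by move=> ?; lra.
  rewrite natrX mulrA ler_pdivlMr // mul1r.
  have : (n%:R + 1) ^+ 2 <= (n%:R + n%:R) ^+ 2 :> R.
    by rewrite lerXn2r ?nnegrE ?addr_ge0 // lerD2l.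
  by move: (n%:R : R) => x ?; lra.
have berr := block_err_bound.
apply: (@le_trans _ _ (P * ((P ^+ 4)^-1 * P ^+ 2 + 2 * (P ^+ 2 * (4 * P)) * (cut_const / P ^+ 5)))).
  have be0 : 0 <= block_err beta n (n * K * l ^ 2 * (l * (9 + b))) (c * l).
    exact: block_err_ge0.
  apply: ler_pM => //.
    by rewrite addr_ge0 // mulr_ge0 ?sqr_ge0 ?exprn_ge0 ?contr_ge // mulr_ge0.
  have nP2 : (n%:R + 1) ^+ 2 <= P ^+ 2 by rewrite lerXn2r // nnegrE // ltW.
  apply: lerD.
    by apply: ler_pM => //; rewrite ?exprn_ge0 ?contr_ge ?sqr_ge0.
  have mP : (n ^ 2 * (4 * l))%:R <= P ^+ 2 * (4 * P) :> R.
    rewrite natrM natrX natrM; apply: ler_pM => //; last by rewrite ler_wpM2l.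
    by rewrite lerXn2r // nnegrE // ltW.
  by apply: ler_pM => //; rewrite ler_wpM2l.
have -> : P * ((P ^+ 4)^-1 * P ^+ 2 + 2 * (P ^+ 2 * (4 * P)) * (cut_const / P ^+ 5)) =
  (1 + 8 * cut_const) / P.
  by move: P P0 => p p0'; field; rewrite gt_eqF.
by rewrite ler_wpM2l ?lef_pV2 // ?posrE // addr_ge0 // mulr_ge0 // cut_const_ge0.
Qed.

Lemma log2_le_ln : l%:R <= 2 / ln 2 * ln (n%:R : R).
Proof.
have ln2 : 0 < ln 2 :> R by rewrite ln_gt0 // ltr1n.
have k1 : (0 < trunc_log 2 n)%N by rewrite trunc_log_gt0.
have h : (trunc_log 2 n)%:R * ln 2 <= ln n%:R :> R.
  rewrite mulr_natl -lnXn // ler_ln ?posrE ?exprn_gt0 ?ltr0n //.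
  by rewrite -natrX ler_nat trunc_logP.
have l2 : l%:R <= 2 * (trunc_log 2 n)%:R :> R.
  by rewrite -natrM ler_nat /log2 mul2n -addnn -addn1 leq_add2l.
rewrite mulrAC ler_pdivlMr //; apply: (@le_trans _ _ (2 * (trunc_log 2 n)%:R * ln 2)).
  by rewrite ler_wpM2r // ltW.
by rewrite -mulrA ler_wpM2l.
Qed.

Lemma mix_timeE : mix_time%:R = (8 * K * (9 + b))%:R * n%:R ^+ 3 * l%:R ^+ 4 :> R.
Proof. by rewrite -!natrX -!natrM; congr (_%:R); rewrite /mix_time; ring. Qed.

End FixedSize.
End MixingTime.

Local Open Scope classical_set_scope.

Theorem theorem4p11 (R : realType) (beta : R) (hbeta : 0 < beta) :
  exists (C : R) (k : nat) (t : nat -> nat),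
    0 < C /\
    (forall n : nat, (2 <= n)%N ->
       (t n)%:R <= C * (n%:R) ^+ 3 * (ln (n%:R : R)) ^+ k) /\
    tv_to_mu beta n (t n) @[n --> \oo] --> (0 : R).
Proof.
set q := expR (- beta); have q0 : 0 < q := q_gt0 beta; have q1 : q < 1 := q_lt1 hbeta.
have p0 : 0 < 1 - q by rewrite subr_gt0.
have [c c0 hc] := exists_pow_le q0 q1.
have r0 : 0 <= q^-1 ^+ c by rewrite exprn_ge0 // invr_ge0 ltW.
have [b hb] := exists_pow2_ge r0.
have K0 : 0 <= 36 * c%:R ^+ 2 / (1 - q) ^+ 2 by rewrite divr_ge0 ?sqr_ge0 // mulr_ge0 ?sqr_ge0.
have := archi_boundP K0; set K := Num.bound _ => /ltW.
rewrite ler_pdivrMr ?exprn_gt0 // => hK.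
have ln2 : 0 < ln 2 :> R by rewrite ln_gt0 // ltr1n.
pose A : R := (8 * K * (9 + b))%:R; pose D : R := 2 / ln 2.
have D0 : 0 <= D by rewrite divr_ge0 // ltW.
(* The exponent [4] is the power of [l] in [mix_timeE], [D] converts [l] into [ln n], and the
   summand [1] makes the constant positive. *)
exists (A * D ^+ 4 + 1), 4%N, (mix_time b K); split.
  by rewrite ltr_wpDl // mulr_ge0 // exprn_ge0.
split => [n n2|].
  have ln0 : 0 <= ln n%:R :> R by rewrite ln_ge0 // ler1n ltnW.
  rewrite mix_timeE // -/A.
  apply: (@le_trans _ _ (A * n%:R ^+ 3 * (D * ln n%:R) ^+ 4)).
    have Dl0 : 0 <= D * ln n%:R by rewrite mulr_ge0.
    rewrite ler_wpM2l ?mulr_ge0 ?exprn_ge0 // lerXn2r ?nnegrE //.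
    exact: log2_le_ln.
  have -> : (A * D ^+ 4 + 1) * n%:R ^+ 3 * ln n%:R ^+ 4 =
    A * n%:R ^+ 3 * (D * ln n%:R) ^+ 4 + n%:R ^+ 3 * ln n%:R ^+ 4 :> R by ring.
  by rewrite lerDl mulr_ge0 ?exprn_ge0.
apply: (@squeeze_cvgr _ _ _ _ (fun=> 0) (fun n => (1 + 8 * cut_const beta c) * harmonic n)).
- near=> n; have n2 : (2 <= n)%N by near: n; exact: nbhs_infty_ge.
  apply/andP; split; first by rewrite mulr_ge0 // sumr_ge0.
  by rewrite /harmonic /= -(natr1 n); exact: tv_mix_time.
- exact: cvg_cst.
- rewrite -[X in _ --> X](mulr0 (1 + 8 * cut_const beta c)).
  by apply: cvgMr; exact: cvg_harmonic.
Unshelve. all: by end_near.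
Qed.
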